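(* Let $S$ be a self-similar IFS of $\mathbb{R}^d$ such that the attractor $K$ is equal to the closure of its interior. Let $\mu$ be a self-similar measure associated with $S$. Let $1\le\tau_1\le\dots\le\tau_d$, $\tau=(\tau_1,\dots,\tau_d)$, and let $(B_n:=B(x_n,r_n))_{n\in\mathbb{N}}$ be a sequence of balls of $\mathbb{R}^d$ satisfying $r_n\to0$ and $\mu(\limsup_{n\to+\infty}B_n)=1$. Let $R_n$ be the interior of $R_\tau(x_n,r_n)$. Then $$\dim_H\Big(\limsup_{n\to+\infty}R_n\Big)\ge\min_{1\le i\le d}\left\{\frac{\dim(\mu)+\sum_{1\le j\le i}(\tau_i-\tau_j)}{\tau_i}\right\}.$$
   Context: $\mathbb{R}^d$ is endowed with $\|\cdot\|_\infty$; $B(x,r)$ is the closed ball; $\limsup_nA_n=\bigcap_N\bigcup_{n\ge N}A_n$. For $x=(x_i)_{1\le i\le d}\in\mathbb{R}^d$ and $r>0$, $R_\tau(x,r)=\prod_{i=1}^d[x_i-\frac12r^{\tau_i},x_i+\frac12r^{\tau_i}]$. A self-similar IFS is a family $S=\{f_i\}_{i=1}^m$ of $m\ge2$ contracting similarities of $\mathbb{R}^d$ (no separation condition is assumed); its attractor is the unique non-empty compact $K$ with $K=\bigcup_if_i(K)$. Given a probability vector $(p_i)\in(0,1)^m$, the associated self-similar measure is the unique probability measure with $\mu=\sum_ip_i\,\mu\circ f_i^{-1}$. Self-similar measures are exact dimensional: $\lim_{r\to0^+}\frac{\log\mu(B(x,r))}{\log r}$ exists and equals a constant $\dim(\mu)$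 for $\mu$-a.e. $x$. *)

(* Defs.v *)
From HB Require Import structures.
From mathcomp Require Import all_boot all_order all_algebra.
From mathcomp Require Import all_classical all_reals all_analysis.

Set Implicit Arguments.
Unset Strict Implicit.
Unset Printing Implicit Defensive.

Import Order.TTheory GRing.Theory Num.Theory.
Import numFieldNormedType.Exports.

Local Open Scope classical_set_scope.
Local Open Scope ring_scope.

(* The canonical norm of 'rV[R]_d in MathComp-Analysis is the sup norm, so
   `| _ |, closed_ball and the topology below are those of R^d with the sup
   norm. *)

(* R^d with its Borel sigma-algebra *)
Notation borel R d := (g_sigma_algebraType (@open 'rV[R]_d)).

Section SelfSimilar.
Context {R : realType} {d : nat}.

(* Similarities are the usual ones, i.e. with respect to the Euclidean norm
   (every sup-norm similarity of R^d is one of these). *)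
Definition euclidean_norm (v : 'rV[R]_d) : R :=
  Num.sqrt (\sum_(i < d) v ord0 i ^+ 2).

Definition contracting_similarity (f : 'rV[R]_d -> 'rV[R]_d) : Prop :=
  exists2 c : R, 0 < c < 1 &
    forall x y, euclidean_norm (f x - f y) = c * euclidean_norm (x - y).

Definition self_similar_IFS (m : nat) (f : 'I_m -> 'rV[R]_d -> 'rV[R]_d) :
    Prop :=
  (2 <= m)%N /\ forall i, contracting_similarity (f i).

Definition is_attractor (m : nat) (f : 'I_m -> 'rV[R]_d -> 'rV[R]_d)
    (K : set 'rV[R]_d) : Prop :=
  [/\ K !=set0, compact K & K = \bigcup_(i in [set: 'I_m]) (f i @` K)].

Definition probability_vector (m : nat) (p : 'I_m -> R) : Prop :=
  (forall i, 0 < p i < 1) /\ \sum_(i < m) p i = 1.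

Definition is_self_similar_measure (m : nat)
    (f : 'I_m -> 'rV[R]_d -> 'rV[R]_d) (p : 'I_m -> R)
    (mu : probability (borel R d) R) : Prop :=
  forall A : set (borel R d), measurable A ->
    mu A = (\sum_(i < m) (p i)%:E * mu (f i @^-1` A))%E.

Definition exact_dimensional (mu : probability (borel R d) R) (a : R) : Prop :=
  {ae mu, forall x : borel R d,
    ln (fine (mu (closed_ball (x : 'rV[R]_d) r))) / ln r @[r --> 0^'+] --> a}.

(* The constant a is unique (see measure_dimE); the default value 0 is only
   taken by measures that are not exact dimensional. *)
Definition measure_dim (mu : probability (borel R d) R) : R :=
  xget 0 [set a | exact_dimensional mu a].

Lemma measure_dimE (mu : probability (borel R d) R) (a : R) :
  exact_dimensional mu a -> measure_dim mu = a.
Proof.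
move=> ha; rewrite /measure_dim; case: xgetP => [b _ /= hb|/(_ a)//].
have mu0 : (0 < mu setT)%E by rewrite probability_setT lte01.
have PF : ProperFilter (almost_everywhere mu).
  exact: ae_properfilter_algebraOfSetsType.
have [x [xa xb]] := filter_ex (filterI ha hb).
exact: (cvg_unique _ xb xa).
Qed.

End SelfSimilar.

Section HausdorffDimension.
Context {R : realType} {d : nat}.
Local Open Scope ereal_scope.

(* sup-norm diameter, with diam set0 = 0 *)
Definition diam (A : set 'rV[R]_d) : \bar R :=
  ereal_sup (0 |` [set (`|z.1 - z.2|%R)%:E | z in A `*` A]).

(* diam(A)^s, with the convention that the empty set has weight 0 even for
   s = 0 (so that the 0-dimensional measure is the counting measure). *)
Definition diam_pow (s : R) (A : set 'rV[R]_d) : \bar R :=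
  if pselect (A = set0) then 0 else poweR (diam A) s.

Definition hausdorff_content (s delta : R) (E : set 'rV[R]_d) : \bar R :=
  ereal_inf [set \sum_(0 <= n <oo) diam_pow s (U n) | U in
    [set U : (set 'rV[R]_d)^nat |
      (forall n, diam (U n) <= delta%:E) /\ E `<=` \bigcup_n U n]].

Definition hausdorff_measure (s : R) (E : set 'rV[R]_d) : \bar R :=
  ereal_sup [set hausdorff_content s delta E |
    delta in [set delta : R | (0 < delta)%R]].

Definition hausdorff_dim (E : set 'rV[R]_d) : \bar R :=
  ereal_inf [set s%:E | s in
    [set s : R | (0 <= s)%R /\ hausdorff_measure s E = 0]].

End HausdorffDimension.

Definition rectangle {R : realType} {d : nat} (tau : 'I_d -> R)
    (x : 'rV[R]_d) (r : R) : set 'rV[R]_d :=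
  [set y | forall i : 'I_d,
    x ord0 i - 2^-1 * powR r (tau i) <= y ord0 i
      <= x ord0 i + 2^-1 * powR r (tau i)].

(* Main.v *)
(* Idea.  Put alpha = dim mu, let sigma < beta < alpha, and suppose that
   E = limsup R_n has H^s(E) = 0 for some s below the bound.  For t slightly larger
   than s cover E by sets A_k of size a_k with sum_k a_k^t tiny, and write load(Q)
   for the sum of a_k^t over the A_k meeting a cube Q.  One builds nested cubes
   Q_0, Q_1, ... such that load(Q_N) <= eps |Q_N|^t and Q_(N+1) lies in the interior
   of some R_n with n >= N.  Their common point is in E but in no A_k, since an A_k
   meeting every Q_N has a_k <= |Q_N| for all N.

   Existence of Q_(N+1).  If no small cube of R_n is admissible, averaging over a
   grid of cubes in R_n gives r_n^sigma <~ load(R_n), provided all A_k meeting R_n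
   are smaller than r_n.  Here sigma = sum_i th_i tau_i, where th is 1 on the first
   floor(t) coordinates, t - floor(t) on the next one and 0 afterwards; the
   condition sigma < alpha is the i = floor(t) + 1 term of the minimum.  If this
   failed for all n, limsup B_n would be covered inside Q_N by the triples of the
   A_k and by balls B_n with r_n^beta <~ r_n^(beta - sigma) load(R_n), of which one
   keeps a net at each dyadic scale.  The sum of the beta-th powers of the radii is
   then small compared with |Q_N|^beta.

   This contradicts a lower bound on the beta-content of limsup B_n inside any cube
   centred on K, uniform in the cube: a small copy g(K) of the attractor sits in the
   cube, mu(g^-1(limsup B_n)) = 1 because mu is self-similar, and mu(B(y,a)) <= C a^beta
   on a set of mu-measure at least 1/2.

   If mu is not exact dimensional then measure_dim mu = 0 and the first term of the
   minimum is 0. *)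

Require Import Defs.
From mathcomp Require Import all_boot all_order all_algebra.
From mathcomp Require Import all_classical all_reals all_analysis.
From mathcomp Require Import ring lra zify.

Set Implicit Arguments.
Unset Strict Implicit.
Unset Printing Implicit Defensive.

Import Order.TTheory GRing.Theory Num.Theory.
Import numFieldNormedType.Exports.

Local Open Scope classical_set_scope.
Local Open Scope ring_scope.

(** * Counting in grids *)

Section SupNorm.
Context {R : realType} {d : nat}.
Implicit Types (u v x y : 'rV[R]_d).

Lemma rV_norm_leP v (e : R) :
  0 <= e -> `|v| <= e <-> forall i, `|v ord0 i| <= e.
Proof.
move=> e0; rewrite /Num.norm /= mx_normrE; split => [h i|h].
  apply: le_trans h.
  exact: (@le_bigmax _ _ _ _ (fun ij : 'I_1 * 'I_d => `|v ij.1 ij.2|) (ord0, i)).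
by apply: bigmax_le => // -[a i] _ /=; rewrite (ord1 a); exact: h.
Qed.

Lemma coord_le_norm v i : `|v ord0 i| <= `|v|.
Proof. exact: (rV_norm_leP v (normr_ge0 v)).1. Qed.

End SupNorm.

Section FiniteCounting.

(** Subtracting the least element of [A] injects [A] into {0, ..., floor B}. *)
Lemma card_diam_le (R : realType) (M : nat) (A : {set 'I_M}) (B : R) :
  0 <= B -> (forall i j, i \in A -> j \in A -> j%:R - i%:R <= B) ->
  #|A|%:R <= B + 1.
Proof.
move=> B0 hA; have [->|/set0Pn[i0 i0A]] := eqVneq A finset.set0.
  by rewrite cards0 addr_ge0.
case: (arg_minnP (fun i : 'I_M => nat_of_ord i) i0A) => i iA imin.
set N := Num.truncn B.
have hN j : j \in A -> (j - i < N.+1)%N.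
  move=> jA; rewrite ltnS truncn_ge_nat// natrB; last exact: imin.
  exact: hA.
pose f (j : 'I_M) : 'I_N.+1 := inord (j - i).
have /leq_card_in : {in A &, injective f}.
  move=> j k jA kA /(congr1 (@nat_of_ord _)).
  rewrite !inordK ?hN// => e; apply: val_inj => /=.
  by rewrite -(subnK (imin _ jA)) e subnK//; exact: imin.
rewrite card_ord -(ler_nat R) => /le_trans; apply.
by rewrite -addn1 natrD lerD2r truncn_le.
Qed.

Lemma card_ffun_proj (d M : nat) (S : {set {ffun 'I_d -> 'I_M}}) :
  (#|S| <= \prod_(i < d) #|[set g i | g : {ffun 'I_d -> 'I_M} in S]%SET|)%N.
Proof.
pose F (i : 'I_d) : pred 'I_M := mem [set g i | g : {ffun 'I_d -> 'I_M} in S]%SET.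
have -> : (\prod_(i < d) #|[set g i | g : {ffun 'I_d -> 'I_M} in S]%SET| =
          #|(family F : simpl_pred _)|)%N.
  by rewrite card_family foldrE big_image.
apply: subset_leq_card; apply/fintype.subsetP => g gS; apply/familyP => i.
by rewrite /F; apply: imset_f.
Qed.

End FiniteCounting.

Section PowR.
Context {R : realType}.
Implicit Types x y u t : R.

Lemma prod_powR (I : finType) x (th : I -> R) : 0 < x ->
  \prod_(i : I) x `^ th i = x `^ (\sum_(i : I) th i).
Proof.
move=> x0; symmetry; apply: (big_morph (powR x)); last by rewrite powRr0.
by move=> a b; rewrite powRD// (gt_eqF x0) implybT.
Qed.

Lemma ler_powRl x y t : 0 <= t -> 0 <= x -> x <= y -> x `^ t <= y `^ t.
Proof.
move=> t0 x0 xy; apply: ge0_ler_powR => //; rewrite nnegrE //.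
exact: le_trans xy.
Qed.

(** Rests on min(1, u) <= u^t for 0 <= t <= 1; it lets each coordinate of a rectangle count with a
    fractional weight. *)
Lemma min1_le_powR u t c M : 0 < u -> 0 <= t <= 1 -> 0 <= M ->
  c <= M -> c <= M * u -> c <= M * u `^ t.
Proof.
move=> u0 /andP[t0 t1] M0 cM cMu; have [u1|u1] := leP u 1.
  apply: le_trans cMu _; rewrite ler_wpM2l//.
  by rewrite ger1_powR// u0.
apply: le_trans cM _; rewrite -{1}[M]mulr1 ler_wpM2l//.
by rewrite -(powRr0 u) ler_powR// ltW.
Qed.

End PowR.

(** One index is kept for each non-empty cell of a grid of side [h] over the cube of radius [l].
    Cells of kept points within 2h of [p] differ by at most 5 in each coordinate, whence 6^d. *)
Lemma exists_net (R : realType) (d : nat) (X : nat -> 'rV[R]_d) (S : set nat)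
    (z : 'rV[R]_d) (l h : R) :
  0 < h -> (forall n, S n -> `|X n - z| <= l) ->
  exists s : seq nat, [/\ forall m, m \in s -> S m,
    forall n, S n -> exists2 m, m \in s & `|X n - X m| <= h &
    forall p, (count (fun m => (`|X m - p| <= 2 * h)%R) s <= 6 ^ d)%N].
Proof.
move=> h0 Sl.
pose u n (i : 'I_d) : R := (X n ord0 i - z ord0 i + l) / h.
pose M := (Num.truncn (2 * l / h)).+1.
pose cl n : {ffun 'I_d -> 'I_M} := [ffun i => inord (Num.truncn (u n i))].
have u0 n i : S n -> 0 <= u n i.
  move=> /Sl hn; apply: divr_ge0; last exact: ltW.
  have := le_trans (coord_le_norm _ i) hn; rewrite !mxE ler_norml => /andP[]; lra.
have uM n i : S n -> (Num.truncn (u n i) < M)%N.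
  move=> Sn; rewrite truncn_lt_nat; last exact: u0.
  apply: le_lt_trans (truncnS_gt _); rewrite ler_pM2r ?invr_gt0//.
  have := le_trans (coord_le_norm _ i) (Sl _ Sn).
  rewrite !mxE ler_norml => /andP[]; lra.
have clE n i : S n -> cl n i = Num.truncn (u n i) :> nat.
  by move=> Sn; rewrite ffunE inordK// uM.
have clP n i : S n -> (cl n i)%:R <= u n i < (cl n i)%:R + 1.
  move=> Sn; rewrite clE// natr1; apply: truncn_itv; exact: u0.
(* The default 0 never appears: only cells with [good v] enter the list. *)
pose rep v : nat := xget 0%N [set n | S n /\ cl n = v].
pose good v := `[< exists n, S n /\ cl n = v >].
have repP v : good v -> S (rep v) /\ cl (rep v) = v.
  move=> /asboolP[n hn].
    exact: (xgetPex 0%N (ex_intro _ n hn : (exists x, [set n | S n /\ cl n = v] x))).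
exists [seq rep v | v <- enum {ffun 'I_d -> 'I_M} & good v]; split.
- by move=> m /mapP[v]; rewrite mem_filter => /andP[/repP[? _] _] ->.
- move=> n Sn; have gn : good (cl n) by apply/asboolP; exists n.
  have [Sr cr] := repP _ gn.
  exists (rep (cl n)); first by apply/mapP; exists (cl n) => //; rewrite mem_filter gn mem_enum.
  apply/(rV_norm_leP _ (ltW h0)) => i; rewrite !mxE.
  have := clP _ i Sn; have := clP _ i Sr; rewrite cr /u.
  rewrite !ler_pdivlMr// !ltr_pdivrMr// => /andP[a1 a2] /andP[b1 b2].
  rewrite ler_norml; apply/andP; split; lra.
- move=> p; rewrite count_map count_filter.
  pose T : {set {ffun 'I_d -> 'I_M}} :=
    [set v | (`|X (rep v) - p| <= 2 * h)%R && good v]%SET.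
  rewrite (_ : count _ _ = #|T|); last first.
    rewrite cardE -size_filter; congr size.
    rewrite {2}/enum_mem -enumT; apply: eq_filter => v /=.
    by rewrite finset.in_set.
  apply: leq_trans (card_ffun_proj T) _.
  rewrite (_ : 6 ^ d = \prod_(i < d) 6)%N; last by rewrite prod_nat_const card_ord.
  apply: leq_prod => i _; rewrite -(ler_nat R).
  have := @card_diam_le R M [set v i | v : {ffun 'I_d -> 'I_M} in T]%SET 5 (ler0n _ _).
  rewrite (_ : 5 + 1 = 6%:R); last by rewrite natr1.
  apply=> j k /imsetP[v]; rewrite finset.in_set => /andP[vp gv] ->.
  move=> /imsetP[w]; rewrite finset.in_set => /andP[wp gw] ->.
  have [Sv cv] := repP _ gv; have [Sw cw] := repP _ gw.
  have /andP[a1 a2] := clP _ i Sv; have /andP[b1 b2] := clP _ i Sw.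
  rewrite cv in a1 a2; rewrite cw in b1 b2.
  have := le_trans (coord_le_norm _ i) vp; have := le_trans (coord_le_norm _ i) wp.
  rewrite !mxE !ler_norml => /andP[c1 c2] /andP[e1 e2].
  have : u (rep w) i - u (rep v) i <= 4.
    rewrite /u -mulrBl ler_pdivrMr//; lra.
  lra.
Qed.

(** * Small cubes inside a rectangle *)

Definition load {R : realType} {V : Type} (A : nat -> set V) (a : nat -> R)
    (t : R) (S : set V) : \bar R :=
  (\sum_(0 <= k <oo) (if `[< A k `&` S !=set0 >] then a k `^ t else 0)%:E)%E.

Section Load.
Context {R : realType} {V : Type} (A : nat -> set V) (a : nat -> R) (t : R).
Implicit Types S : set V.

Lemma load_term_ge0 k S :
  0 <= (if `[< A k `&` S !=set0 >] then a k `^ t else 0).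
Proof. by case: ifP => // _; exact: powR_ge0. Qed.

Lemma load_ge0 S : (0 <= load A a t S)%E.
Proof. by apply: nneseries_ge0 => k _ _; rewrite lee_fin load_term_ge0. Qed.

Lemma nneseries_term_le (u : nat -> \bar R) k :
  (forall n, 0 <= u n)%E -> (u k <= \sum_(0 <= n <oo) u n)%E.
Proof.
move=> u0; rewrite (@nneseriesD1 _ _ k _ (fun n _ => u0 n))//.
by apply: leeDl; apply: nneseries_ge0.
Qed.

Lemma load_ge k S : A k `&` S !=set0 -> ((a k `^ t)%:E <= load A a t S)%E.
Proof.
move=> kS; apply: le_trans (@nneseries_term_le _ k _); last first.
  by move=> n; rewrite lee_fin load_term_ge0.
by rewrite ifT//; apply/asboolP.
Qed.

End Load.

(* Averaging over the cubes of radius rho centred at a grid of M^d points of the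
   rectangle.  A set of size a meets at most a fraction
   prod_i min(1, 8 max(a, rho) / r^tau_i) of these cubes, and
   min(1, u) <= u^th for every 0 <= th <= 1. *)
Lemma rectangle_good_ball (R : realType) (d : nat) (tau th : 'I_d -> R)
    (T t r eps : R) (x : 'rV[R]_d) (A : nat -> set 'rV[R]_d) (a : nat -> R) :
  0 < r <= 1 -> 1 <= T -> (forall i, 0 <= tau i <= T) ->
  (forall i, 0 <= th i <= 1) -> t = \sum_i th i -> 0 <= t ->
  (forall k, 0 < a k) -> (forall k y z, A k y -> A k z -> `|y - z| <= a k) ->
  0 < eps <= 1 ->
  ((8 `^ t * r `^ (- \sum_i tau i * th i))%:E *
    load A a t (rectangle tau x r) < eps%:E)%E ->
  exists y rho, [/\ 0 < rho <= r / 8,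
    closed_ball y rho `<=` interior (rectangle tau x r) &
    (load A a t (closed_ball y rho) <= (eps * rho `^ t)%:E)%E].
Proof.
move=> /andP[r0 r1] T1 tauT th01 tE t0 a0 diamA /andP[eps0 eps1] hload.
set C := 8 `^ t * _ in hload.
have C0 : 0 <= C by rewrite mulr_ge0 ?powR_ge0.
(* r^T is at most every side r^tau_i, so a cube of radius [rho] centred in the middle half of the
   rectangle stays off its boundary. *)
pose rho := r `^ T / 8.
have rT0 : 0 < r `^ T by rewrite powR_gt0.
have rho0 : 0 < rho by rewrite divr_gt0.
have rtT i : r `^ T <= r `^ (tau i).
  by rewrite ger_powR ?r0 ?r1//; case/andP: (tauT i).
have rt0 i : 0 < r `^ (tau i) by rewrite powR_gt0.
have rt1 i : r `^ (tau i) <= 1.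
  by rewrite -(powRr0 r) ger_powR ?r0 ?r1//; case/andP: (tauT i).
have rTr : r `^ T <= r by rewrite ge1r_powR ?r0.
(* There are [M] grid points per coordinate; M rho >= 1 lets the additive 1 in the later counts be
   absorbed. *)
pose M := (Num.truncn rho^-1).+1.
have M0 : 0 < M%:R :> R by rewrite ltr0n.
have Mrho : 1 <= M%:R * rho.
  by rewrite -ler_pdivrMr// div1r ltW// truncnS_gt.
pose y (g : {ffun 'I_d -> 'I_M}) : 'rV[R]_d :=
  \row_i (x ord0 i - r `^ (tau i) / 4 + (g i)%:R * (r `^ (tau i) / (2 * M%:R))).
have yx g i : `|y g ord0 i - x ord0 i| <= r `^ (tau i) / 4.
  rewrite mxE; set q := r `^ (tau i).
  have h : (g i)%:R * (q / (2 * M%:R)) <= q / 2.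
    rewrite (_ : q / 2 = M%:R * (q / (2 * M%:R))); last by field; rewrite gt_eqF.
    by rewrite ler_wpM2r ?ler_nat 1?ltnW// divr_ge0 ?mulr_ge0// ltW// rt0.
  have h' : 0 <= (g i)%:R * (q / (2 * M%:R)).
    by rewrite mulr_ge0// divr_ge0 ?mulr_ge0// ltW// rt0.
  rewrite ler_norml; apply/andP; split; lra.
have ballP g : closed_ball (y g) rho `<=` interior (rectangle tau x r).
  rewrite closed_ballE// => w; rewrite /closed_ball_ /= => hw.
  apply/nbhs_ballP; exists (r `^ T / 16); first by rewrite /= divr_gt0.
  move=> v; rewrite -ball_normE /ball_ /= => hv i.
  have := le_trans (coord_le_norm _ i) hw.
  have := le_lt_trans (coord_le_norm _ i) hv.
  have := yx g i; have := rtT i; rewrite !mxE !ler_norml ltr_norml /rho.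
  by move=> h1 /andP[h2 h3] /andP[h4 h5] /andP[h6 h7]; apply/andP; split; lra.
apply: contrapT => bad.
have {}bad g : ((eps * rho `^ t)%:E < load A a t (closed_ball (y g) rho))%E.
  rewrite ltNge; apply/negP => good; apply: bad; exists (y g), rho; split=> //.
  by rewrite rho0 ler_pM2r// invr_gt0.
(* Terms are capped at rho^t. A set with a_k >= rho meeting a cube already gives rho^t >= eps rho^t,
   so every cube stays bad, while the total over the grid becomes proportional to rho^t a_k^t. *)
pose W g k := if `[< A k `&` closed_ball (y g) rho !=set0 >]
  then Num.min (a k) rho `^ t else 0.
have W0 g k : 0 <= W g k by rewrite /W; case: ifP => // _; exact: powR_ge0.
have badW g : ((eps * rho `^ t)%:E <= \sum_(0 <= k <oo) (W g k)%:E)%E.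
  have [[k [mk ak]]|nok] := pselect (exists k,
      A k `&` closed_ball (y g) rho !=set0 /\ rho <= a k).
    apply: le_trans (@nneseries_term_le _ _ k _); last by move=> n; rewrite lee_fin.
    rewrite lee_fin /W ifT; last exact/asboolP.
    by rewrite min_r// ler_piMl// powR_ge0.
  rewrite (_ : (\sum_(0 <= k <oo) (W g k)%:E)%E = load A a t (closed_ball (y g) rho)).
    exact: ltW.
  apply: eq_eseriesr => k _; rewrite /W; case: ifP => // /asboolP mk.
  by rewrite min_l// leNgt; apply/negP => ak; apply: nok; exists k; split=> //; exact: ltW.
have cardW k : \sum_g W g k <= M%:R ^+ d * C * rho `^ t *
    (if `[< A k `&` rectangle tau x r !=set0 >] then a k `^ t else 0).
  pose G : {set {ffun 'I_d -> 'I_M}} :=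
    [set g | `[< A k `&` closed_ball (y g) rho !=set0 >]]%SET.
  have -> : \sum_g W g k = #|G|%:R * Num.min (a k) rho `^ t.
    rewrite mulr_natl -sumr_const [RHS]big_mkcond; apply: eq_bigr => g _.
    by rewrite /W finset.in_set.
  have [->|/set0Pn[g0]] := eqVneq G finset.set0.
    rewrite cards0 mul0r mulr_ge0// ?load_term_ge0//.
    by rewrite !mulr_ge0// ?powR_ge0// exprn_ge0.
  rewrite finset.in_set => /asboolP[w0 [Aw0 Bw0]].
  rewrite ifT; last first.
    apply/asboolP; exists w0; split=> //; exact: interior_subset (ballP _ _ Bw0).
  (* The maximum governs how many cubes [A k] meets, the minimum is the base of the capped term;
     their product is a_k rho. *)
  set b := Num.max (a k) rho; set m := Num.min (a k) rho.
  have b0 : 0 < b by rewrite lt_max rho0 orbT.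
  have m0 : 0 < m by rewrite lt_min rho0 a0.
  have mb : m * b = a k * rho by rewrite /m /b; case: (ltP (a k) rho) => // _; rewrite mulrC.
  pose u i := 8 * b / r `^ (tau i).
  have u0 i : 0 < u i by rewrite divr_gt0// mulr_gt0.
  (* Centres of cubes meeting [A k] differ by at most a_k + 2 rho <= 3b in a coordinate, and the
     spacing is r^tau_i / (2M). This gives 6 M b / r^tau_i + 1, and raising 6 to 8 absorbs the 1. *)
  have proj i : #|[set g i | g : {ffun 'I_d -> 'I_M} in G]%SET|%:R <= M%:R * u i `^ th i.
    apply: min1_le_powR => //.
      by rewrite ler_nat -[X in (_ <= X)%N]card_ord max_card.
    apply: (@le_trans _ _ (6 * M%:R * b / r `^ (tau i) + 1)).
      apply: card_diam_le; first by rewrite divr_ge0 ?mulr_ge0// ltW.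
      move=> j j' /imsetP[g]; rewrite finset.in_set => /asboolP[p [Ap Bp]] ->.
      move=> /imsetP[g']; rewrite finset.in_set => /asboolP[p' [Ap' Bp']] ->.
      rewrite ler_pdivlMr//.
      move: Bp Bp'; rewrite !closed_ballE// /closed_ball_ /= => Bp Bp'.
      have := le_trans (coord_le_norm _ i) (diamA k _ _ Ap' Ap).
      have := le_trans (coord_le_norm _ i) Bp.
      have := le_trans (coord_le_norm _ i) Bp'.
      have : a k <= b /\ rho <= b by rewrite /b !le_max !lexx orbT.
      rewrite !mxE; set q := r `^ _.
      have gE (h : {ffun 'I_d -> 'I_M}) :
          (h i)%:R * (q / (2 * M%:R)) * (2 * M%:R) = (h i)%:R * q.
        by rewrite -mulrA mulfVK// mulf_neq0// gt_eqF.
      rewrite !ler_norml => -[ab rb] /andP[e1 e2] /andP[e3 e4] /andP[e5 e6].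
      have : (g' i)%:R * (q / (2 * M%:R)) - (g i)%:R * (q / (2 * M%:R)) <= 3 * b by lra.
      have M2 : 0 <= 2 * M%:R :> R by rewrite mulr_ge0// ltW.
      move=> /(ler_wpM2r M2); rewrite mulrBl !gE mulrBl; lra.
    rewrite /u !mulrA -lerBrDl -mulrBl ler_pdivlMr// mul1r.
    have : M%:R * rho <= M%:R * b by rewrite ler_pM2l// /b le_max lexx orbT.
    have := rt1 i; lra.
  have cardG : #|G|%:R <= M%:R ^+ d * ((8 * b) `^ t * r `^ (- \sum_i tau i * th i)).
    apply: (@le_trans _ _ (\prod_(i < d) (M%:R * u i `^ th i))).
      apply: (@le_trans _ _ (\prod_(i < d)
          #|[set g i | g : {ffun 'I_d -> 'I_M} in G]%SET|)%:R).
        by rewrite ler_nat card_ffun_proj.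
      by rewrite natr_prod; apply: ler_prod => i _; rewrite ler0n proj.
    rewrite big_split /= prodr_const card_ord ler_wpM2l ?exprn_ge0//.
    rewrite /u.
    under eq_bigr => i _ do rewrite powRM ?invr_ge0 ?mulr_ge0 ?(ltW b0) ?(ltW (rt0 i))//
      -powRN -powRrM mulNr.
    rewrite big_split /= prod_powR ?mulr_gt0// -tE -sumrN.
    by rewrite prod_powR.
  apply: (le_trans (ler_wpM2r (powR_ge0 _ _) cardG)).
  have e : (8 * b) `^ t * m `^ t = 8 `^ t * (rho `^ t * a k `^ t).
    have b8 : 0 <= 8 * b by rewrite mulr_ge0// ltW.
    have ra : 0 <= rho * a k by rewrite ltW// (mulr_gt0 rho0 (a0 k)).
    rewrite -(powRM t (ltW rho0) (ltW (a0 k))) -(powRM t b8 (ltW m0)) -(powRM t _ ra)//.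
    by rewrite -mulrA [b * m]mulrC mb [a k * _]mulrC.
  rewrite le_eqVlt; apply/orP; left; apply/eqP; rewrite /C.
  transitivity (M%:R ^+ d * r `^ (- \sum_i tau i * th i) * ((8 * b) `^ t * m `^ t)).
    by rewrite -!mulrA; congr (_ * _); rewrite mulrCA.
  by rewrite e -!mulrA; congr (_ * _); rewrite mulrCA.
(* Summing over all M^d cubes and exchanging the sums contradicts [hload] once M^d rho^t is
   cancelled. *)
have : ((M%:R ^+ d * (eps * rho `^ t))%:E <=
    (M%:R ^+ d * C * rho `^ t)%:E * load A a t (rectangle tau x r))%E.
  rewrite -nneseriesZl; last by move=> k _; rewrite lee_fin load_term_ge0.
  apply: (@le_trans _ _ (\sum_(0 <= k <oo) \sum_g (W g k)%:E)%E).
    rewrite nneseries_sum; last by move=> *; rewrite lee_fin.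
    apply: (@le_trans _ _ (\sum_(g : {ffun 'I_d -> 'I_M}) (eps * rho `^ t)%:E)%E).
      rewrite sumEFin lee_fin sumr_const card_ffun !card_ord.
      by rewrite -natrX mulr_natl.
    by apply: lee_sum => g _.
  apply: lee_nneseries => k _.
    by move=> _; rewrite sumEFin lee_fin; apply: sumr_ge0 => g _.
  by rewrite sumEFin -EFinM lee_fin.
apply/negP; rewrite -ltNge.
rewrite (_ : M%:R ^+ d * C * rho `^ t = M%:R ^+ d * rho `^ t * C); last by rewrite mulrAC.
rewrite (_ : M%:R ^+ d * (eps * rho `^ t) = M%:R ^+ d * rho `^ t * eps); last first.
  by rewrite -mulrA [eps * _]mulrC.
rewrite [in X in (X < _)%E]EFinM -muleA [X in (_ < X)%E]EFinM.
by rewrite lte_pmul2l// lte_fin mulr_gt0// ?exprn_gt0 ?powR_gt0.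
Qed.

(** After exchanging the sums, each [A k] is counted at most [c] times. *)
Lemma load_multiplicity (R : realType) (V : Type) (A : nat -> set V) (a : nat -> R)
    (t : R) (S : nat -> set V) (s : seq nat) (c : nat) (Q : set V) :
  (forall k, count (fun m => `[< A k `&` S m !=set0 >]) s <= c)%N ->
  (forall m, m \in s -> S m `<=` Q) ->
  (\sum_(m <- s) load A a t (S m) <= c%:R%:E * load A a t Q)%E.
Proof.
move=> hc SQ; rewrite -nneseriesZl; last by move=> k _; rewrite lee_fin load_term_ge0.
rewrite -nneseries_sum; last by move=> *; rewrite lee_fin load_term_ge0.
apply: lee_nneseries => k _; rewrite sumEFin ?lee_fin.
  by move=> _; apply: sumr_ge0 => m _; exact: load_term_ge0.
rewrite -big_mkcond/= big_const_seq iter_addr_0.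
have [->|] := eqVneq (count (fun m => `[< A k `&` S m !=set0 >]) s) 0%N.
  by rewrite mulr0n mulr_ge0// load_term_ge0.
rewrite -lt0n -has_count => /hasP[m ms /asboolP[w [Aw Sw]]].
rewrite ifT; last by apply/asboolP; exists w; split=> //; exact: (SQ m).
by rewrite -[_ *+ _]mulr_natl ler_wpM2r ?powR_ge0// ler_nat.
Qed.

Lemma rectangle_norm_le (R : realType) (d : nat) (tau : 'I_d -> R)
    (x w : 'rV[R]_d) (r : R) :
  0 < r <= 1 -> (forall i, 1 <= tau i) -> rectangle tau x r w -> `|x - w| <= r / 2.
Proof.
move=> /andP[r0 r1] tau1 hw; apply/rV_norm_leP => [|i]; first by rewrite divr_ge0// ltW.
have : r `^ tau i <= r by rewrite ge1r_powR ?r0.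
have := hw i; rewrite !mxE ler_norml => /andP[h1 h2] h3; apply/andP; split; lra.
Qed.

Lemma nneseries_geometric_le (R : realType) (c q : R) : 0 <= c -> 0 <= q < 1 ->
  (\sum_(0 <= j <oo) (c * q ^+ j)%:E <= (c / (1 - q))%:E)%E.
Proof.
move=> c0 /andP[q0 q1].
apply: lime_le; first by apply: is_cvg_nneseries => n _ _; rewrite lee_fin mulr_ge0// exprn_ge0.
apply: nearW => n; rewrite sumEFin lee_fin.
have -> : \sum_(0 <= k < n) c * q ^+ k = c * (1 - q ^+ n) / (1 - q).
  have q1' : q != 1 by rewrite lt_eqF.
  by have :=  geometric_seriesE c q1'; move=> /(congr1 (fun f => f n)) /= <-.
rewrite ler_pM2r ?invr_gt0 ?subr_gt0// ler_piMr// gerBl exprn_ge0//.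
Qed.

Lemma dyadic_level (R : realType) (r h : R) : 0 < r <= h ->
  exists j : nat, h / 2 ^+ j / 2 < r <= h / 2 ^+ j.
Proof.
move=> /andP[r0 rh].
have [n hn] : exists n : nat, h / 2 ^+ n / 2 < r.
  exists (Num.truncn (h / r)).+1.
  rewrite ltr_pdivrMr// ltr_pdivrMr ?exprn_gt0//.
  have h1 : h / r < 2 ^+ (Num.truncn (h / r)).+1.
    apply: lt_le_trans (truncnS_gt _) _; rewrite -natrX ler_nat ltnW// ltn_expl//.
  move: h1; rewrite ltr_pdivrMr// => h1; apply: lt_le_trans h1 _.
  have : 0 <= r * 2 ^+ (Num.truncn (h / r)).+1 by rewrite mulr_ge0 ?exprn_ge0// ltW.
  lra.
case: (ex_minnP (ex_intro (fun n : nat => h / 2 ^+ n / 2 < r) n hn)) => j hj jmin.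
exists j; rewrite hj /=; case: j hj jmin => [|j] hj jmin; first by rewrite expr0 divr1.
rewrite leNgt; apply/negP => hlt.
have : h / 2 ^+ j / 2 < r by move: hlt; rewrite exprSr invfM mulrA.
by move=> /jmin; rewrite ltnn.
Qed.

(** * The inductive step *)

(* The covers come as sequences of finite lists: level j of a cover will contain
   both one enlarged set of a given cover and a whole net of rectangles of size
   comparable to 2^-j. *)
Definition ball_content_ge {R : realType} {d : nat} (L : set 'rV[R]_d)
    (beta kappa : R) (z : 'rV[R]_d) (l : R) : Prop :=
  forall s : nat -> seq ('rV[R]_d * R),
    (forall j b, b \in s j -> 0 < b.2) ->
    (forall y, L y -> `|y - z| <= l / 2 ->
      exists j, exists2 b, b \in s j & `|y - b.1| <= b.2) ->
    ((kappa * l `^ beta)%:E <=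
      \sum_(0 <= j <oo) (\sum_(b <- s j) b.2 `^ beta)%:E)%E.

Section Step.
Context {R : realType} {d : nat} (tau th : 'I_d -> R) (t beta : R)
  (x : nat -> 'rV[R]_d) (r : nat -> R) (A : nat -> set 'rV[R]_d) (a : nat -> R).
Hypothesis tau1 : forall i, 1 <= tau i.
Hypothesis th01 : forall i, 0 <= th i <= 1.
Hypothesis tE : t = \sum_i th i.
Hypothesis t0 : 0 < t.
Hypothesis tbeta : \sum_i tau i * th i < beta.
Hypothesis r0 : forall n, 0 < r n.
Hypothesis rcvg : r n @[n --> \oo] --> 0.
Hypothesis a0 : forall k, 0 < a k.
Hypothesis diamA : forall k y z, A k y -> A k z -> `|y - z| <= a k.

Let sigma := \sum_i tau i * th i.
Let rect n := rectangle tau (x n) (r n).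

Let t_le_sigma : t <= sigma.
Proof.
rewrite tE; apply: ler_sum => i _; have /andP[h _] := th01 i.
by rewrite ler_peMl.
Qed.

(** Supplies the common bound [T] for [rectangle_good_ball]; the summand 1 ensures T >= 1. *)
Let tau_le i : 0 <= tau i <= 1 + \sum_j tau j.
Proof.
have h j : 0 <= tau j := le_trans ler01 (tau1 j).
rewrite h /= (bigD1 i)//= addrCA lerDl addr_ge0// sumr_ge0// => j _.
Qed.

(** Contrapositive of [rectangle_good_ball], multiplied by r_n^beta. Since r_n <= l/4 and |x_n - z|
    <= 3l/4, the rectangle lies in the cube of radius [l] about [z], so a good cube in it would be
    an admissible successor. *)
Let bad_rectangle (eps : R) (z : 'rV[R]_d) (l : R) n :
  0 < eps <= 1 -> 0 < l <= 1 -> r n <= l / 4 -> `|x n - z| <= 3 / 4 * l ->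
  ~ (exists z' l', [/\ 0 < l' <= l / 2,
      closed_ball z' l' `<=` interior (rect n),
      closed_ball z' l' `<=` closed_ball z l &
      (load A a t (closed_ball z' l') <= (eps * l' `^ t)%:E)%E]) ->
  ((eps * r n `^ beta)%:E <=
     (8 `^ t * r n `^ (beta - sigma))%:E * load A a t (rect n))%E.
Proof.
move=> eps01 /andP[l0 l1] rl xz bad.
have r1 : 0 < r n <= 1 by rewrite r0 /=; lra.
rewrite leNgt; apply/negP => hlt; apply: bad.
have hlt' : ((8 `^ t * r n `^ (- sigma))%:E * load A a t (rect n) < eps%:E)%E.
  have rb : (0 : R) < r n `^ beta by rewrite powR_gt0.
  rewrite -(@lte_pmul2l _ (r n `^ beta)%:E)// ?lte_fin//.
  rewrite muleA -!EFinM [r n `^ beta * eps]mulrC.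
  rewrite (_ : r n `^ beta * _ = 8 `^ t * r n `^ (beta - sigma))//.
  by rewrite mulrCA -powRD// (gt_eqF (r0 n)) implybT.
have T1 : 1 <= 1 + \sum_j tau j.
  by rewrite lerDl sumr_ge0// => j _; exact: le_trans ler01 (tau1 j).
have [y [rho [/andP[rho0 rhor] sub ld]]] :=
  rectangle_good_ball r1 T1 tau_le th01 tE (ltW t0) a0 diamA eps01 hlt'.
exists y, rho; split => //; first by rewrite rho0 /=; lra.
move=> w /sub/interior_subset /(rectangle_norm_le r1 tau1) hw.
rewrite closed_ballE// /closed_ball_ /=.
apply: le_trans (ler_distD (x n) _ _) _; rewrite [`|z - _|]distrC; lra.
Qed.

(** Without such a cube, the limsup within l/2 of [z] is covered by triples of the [A k] and by
    balls of radius 4 r_m about net points. Each family costs at most kappa l^beta / 4, too little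
    for the content. *)
Lemma covering_step (kappa eps : R) (z : 'rV[R]_d) (l : R) (N : nat) :
  0 < kappa -> 0 < eps <= 1 -> 3 `^ beta * eps <= kappa / 4 -> 0 < l <= 1 ->
  ball_content_ge (lim_sup_set (fun n => closed_ball (x n) (r n))) beta kappa z l ->
  (load A a t (closed_ball z l) <= (eps * l `^ t)%:E)%E ->
  exists n z' l', [/\ (N <= n)%N, 0 < l' <= l / 2,
    closed_ball z' l' `<=` interior (rect n),
    closed_ball z' l' `<=` closed_ball z l &
    (load A a t (closed_ball z' l') <= (eps * l' `^ t)%:E)%E].
Proof.
move=> kappa0 eps01 epsk l01 content ldQ; apply: contrapT => nostep.
have /andP[eps0 eps1] := eps01; have /andP[l0 l1] := l01.
set Q := closed_ball z l in ldQ *.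
have bt : t < beta by apply: le_lt_trans tbeta; exact: t_le_sigma.
have b0 : 0 < beta by apply: lt_trans bt.
pose delta := beta - sigma.
have delta0 : 0 < delta by rewrite subr_gt0.
(* Ratio of the bounds at consecutive dyadic levels, coming from the surplus exponent beta -
   sigma. *)
pose q := 2 `^ (- delta) : R.
have q0 : 0 < q by rewrite powR_gt0.
have q1 : q < 1.
  rewrite /q powRN invf_lt1 ?powR_gt0//.
  apply: (@le_lt_trans _ _ (1 `^ delta)); first by rewrite powR1.
  by apply: gt0_ltr_powR; rewrite ?nnegrE// ltr1n.
(* The levels are chosen deep enough for the small rectangles to contribute at
   most a quarter of the content. *)
pose C := 4 `^ beta * (8 `^ t * (6 ^ d)%:R * l `^ t) : R.
have C0 : 0 < C by rewrite !mulr_gt0 ?powR_gt0// ltr0n expn_gt0.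
have lb0 : 0 < l `^ beta by rewrite powR_gt0.
have [J [JC Jl]] : exists J : nat, C * q ^+ J / (1 - q) <= kappa / 4 * l `^ beta /\
    1 / 2 ^+ J <= l / 4.
  have e1 : 0 < kappa / 4 * l `^ beta * (1 - q) / C.
    by rewrite divr_gt0// mulr_gt0 ?subr_gt0// mulr_gt0// divr_gt0.
  have /cvgrPdist_lt/(_ _ e1) cq : q ^+ n @[n --> \oo] --> (0 : R).
    by apply: cvg_expr; rewrite ger0_norm// ltW.
  have e2 : 0 < l / 4 by rewrite divr_gt0.
  have /cvgrPdist_lt/(_ _ e2) ch : 2^-1 ^+ n @[n --> \oo] --> (0 : R).
    by apply: cvg_expr; rewrite ger0_norm// invf_lt1// ltr1n.
  have [J [J1 J2]] := filter_ex (filterI cq ch); exists J; split.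
    move: J1; rewrite sub0r normrN ger0_norm ?exprn_ge0 ?(ltW q0)//.
    rewrite ltr_pdivlMr// => /ltW J1; rewrite ler_pdivrMr ?subr_gt0//.
    by rewrite mulrC.
  move: J2; rewrite sub0r normrN ger0_norm ?exprn_ge0// exprVn div1r; exact: ltW.
have h0 : 0 < 1 / 2 ^+ J :> R by rewrite divr_gt0// exprn_gt0.
pose h j : R := 1 / 2 ^+ J / 2 ^+ j.
have hj0 j : 0 < h j by rewrite divr_gt0// exprn_gt0.
have hjl j : h j <= l / 4.
  apply: le_trans Jl; rewrite ler_pdivrMr ?exprn_gt0// ler_peMr ?(ltW h0)//.
  by rewrite exprn_ege1// ler1n.
have [N0 [NN0 rN0]] : exists N0, (N <= N0)%N /\ forall n, (N0 <= n)%N -> r n <= 1 / 2 ^+ J.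
  have /cvgrPdist_lt/(_ _ h0)[n1 _ hn1] := rcvg.
  exists (maxn N n1); split; first exact: leq_maxl.
  move=> n; rewrite geq_max => /andP[_ /hn1].
  by rewrite sub0r normrN ger0_norm; [exact: ltW|exact/ltW].
(* If [rect n] meets some [A k] with a_k >= r_n, the triple of that [A k] contains B_n; only the
   other n need a net. *)
pose small n := forall k, A k `&` rect n !=set0 -> a k < r n.
pose S j : set nat := [set n | [/\ (N0 <= n)%N, h j / 2 < r n <= h j,
  `|x n - z| <= 3 / 4 * l & small n]].
have rectQ n j : S j n -> rect n `<=` Q.
  move=> [_ /andP[_ rn] xn _] w.
  have r1 : 0 < r n <= 1 by rewrite r0 /=; have := hjl j; lra.
  move=> /(rectangle_norm_le r1 tau1) hw.
  rewrite /Q closed_ballE// /closed_ball_ /=.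
  apply: le_trans (ler_distD (x n) _ _) _; rewrite [`|z - _|]distrC; have := hjl j; lra.
have net j := @exists_net R d x (S j) z (3 / 4 * l) (h j) (hj0 j)
  (fun n (Sn : S j n) => let: And4 _ _ hn _ := Sn in hn).
have [s sP] := choice net.
have /choice[p pP] : forall k, exists v, A k !=set0 -> A k v.
  move=> k; have [[w Aw]|nA] := pselect (A k !=set0); first by exists w.
  by exists 0.
pose big k := `[< A k `&` Q !=set0 >].
(* Here j indexes both a set [A j] and an unrelated scale h_j. Radius 3 a_k suffices since r_n +
   r_n/2 + a_k <= 5 a_k / 2 when r_n <= a_k; radius 4 r_m suffices since |y - x_n| and |x_n - x_m|
   are at most h_j < 2 r_m. *)
pose sl j : seq ('rV[R]_d * R) :=
  (if big j then [:: (p j, 3 * a j)] else [::]) ++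
  [seq (x m, 4 * r m) | m <- s j].
have := content sl.
have sl0 j b : b \in sl j -> 0 < b.2.
  rewrite mem_cat => /orP[|/mapP[m _ ->]]; last by rewrite mulr_gt0.
  by case: ifP => // _; rewrite inE => /eqP ->; rewrite mulr_gt0.
move=> /(_ sl0) hcontent.
have cover y : lim_sup_set (fun n => closed_ball (x n) (r n)) y ->
    `|y - z| <= l / 2 -> exists j, exists2 b, b \in sl j & `|y - b.1| <= b.2.
  move=> /(_ N0 I)[n /= N0n]; rewrite closed_ballE// /closed_ball_ /= => yn yz.
  have rn := rN0 _ N0n.
  have r1 : 0 < r n <= 1 by rewrite r0 /=; lra.
  have xz : `|x n - z| <= 3 / 4 * l.
    apply: le_trans (ler_distD y _ _) _; lra.
  have [[k [[w [Aw Rw]] rk]]|nobig] := pselect (exists k,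
      A k `&` rect n !=set0 /\ r n <= a k).
    have hw := rectangle_norm_le r1 tau1 Rw.
    exists k, (p k, 3 * a k).
      rewrite mem_cat /big ifT ?inE ?eqxx//; exists w; split=> //.
      rewrite /Q closed_ballE// /closed_ball_ /=.
      apply: le_trans (ler_distD (x n) _ _) _; rewrite [`|z - _|]distrC; lra.
    rewrite /=.
    apply: le_trans (ler_distD w _ _) _.
    have := diamA Aw (pP k (ex_intro _ w Aw)).
    have := ler_distD (x n) y w; rewrite [`|y - x n|]distrC; have := r0 n; lra.
  have smalln : small n.
    by move=> k kn; rewrite ltNge; apply/negP => rk; apply: nobig; exists k.
  have [j hj] := @dyadic_level R (r n) (1 / 2 ^+ J) (introT andP (conj (r0 n) rn)).
  have [sS sd _] := sP j.
  have [m ms mn] := sd n (And4 N0n hj xz smalln).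
  have [_ /andP[hm _] _ _] := sS m ms.
  exists j, (x m, 4 * r m).
    by rewrite mem_cat; apply/orP; right; apply/mapP; exists m.
  rewrite /=.
  apply: le_trans (ler_distD (x n) _ _) _; rewrite [`|y - _|]distrC.
  have /andP[_ hj'] : h j / 2 < r n <= h j := hj.
  move: mn yn hj' hm; rewrite /=; lra.
move: hcontent => /(_ cover).
have part1 j : (\sum_(b <- (if big j then [:: (p j, 3 * a j)] else [::])) b.2 `^ beta)
    <= 3 `^ beta * l `^ (beta - t) * (if big j then a j `^ t else 0).
  rewrite /big; case: ifPn => [/asboolP jQ|_]; last by rewrite big_nil mulr0.
  rewrite big_seq1 /= powRM ?(ltW (a0 j))// -mulrA ler_wpM2l ?powR_ge0//.
  (* If a_j > l, one term of the load of [Q] would exceed eps l^t. With a_j <= l the exponent drops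
     from beta to t at the cost of l^(beta - t). *)
  have aj : a j <= l.
    rewrite leNgt; apply/negP => la.
    have := le_trans (load_ge a t jQ) ldQ; rewrite lee_fin; apply/negP; rewrite -ltNge.
    apply: (@le_lt_trans _ _ (l `^ t)); first by rewrite ler_piMl// powR_ge0.
    by apply: gt0_ltr_powR; rewrite ?nnegrE ?(ltW l0) ?(ltW (a0 j)).
  have -> : beta = (beta - t) + t by rewrite subrK.
  rewrite powRD ?(gt_eqF (a0 j)) ?implybT// addrK ler_wpM2r ?powR_ge0//.
  by apply: ler_powRl => //; [rewrite subr_ge0 ltW|exact: ltW].
have part2 j : ((\sum_(b <- [seq (x m, 4 * r m) | m <- s j]) b.2 `^ beta)%:E <=
    (C * q ^+ J * q ^+ j)%:E)%E.
  have [sS _ sc] := sP j.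
  rewrite big_map /=.
  have hd : h j `^ delta = q ^+ J * q ^+ j.
    rewrite /q -exprD -powR_mulrn ?powR_ge0// -powRrM /h div1r -invfM -exprD.
    by rewrite -powR_inv1 ?exprn_ge0// -powR_mulrn// -!powRrM; congr powR; ring.
  (* [bad_rectangle] controls eps r_m^beta; the extra eps cancels against the load of [Q], which is
     at most eps l^t. *)
  rewrite -(@lee_pmul2l _ eps%:E)// -EFinM.
  apply: (@le_trans _ _ (\sum_(m <- s j) (4 `^ beta * 8 `^ t * h j `^ delta)%:E *
      load A a t (rect m))%E).
    rewrite mulr_sumr -sumEFin [X in (X <= _)%E]big_seq [X in (_ <= X)%E]big_seq.
    apply: lee_sum => m ms.
    have [N0m /andP[hm1 hm2] xm sm] := sS m ms.
    have rl : r m <= l / 4 by apply: le_trans hm2 (hjl j).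
    have bad : ~ (exists z' l', [/\ 0 < l' <= l / 2,
        closed_ball z' l' `<=` interior (rect m),
        closed_ball z' l' `<=` closed_ball z l &
        (load A a t (closed_ball z' l') <= (eps * l' `^ t)%:E)%E]).
      move=> [z' [l' [? ? ? ?]]]; apply: nostep; exists m, z', l'; split=> //.
      exact: leq_trans NN0 N0m.
    have := bad_rectangle eps01 l01 rl xm bad.
    move=> hb; rewrite powRM ?(ltW (r0 m))// mulrCA EFinM.
    apply: (@le_trans _ _ ((4 `^ beta)%:E *
      ((8 `^ t * r m `^ (beta - sigma))%:E * load A a t (rect m)))%E).
      by apply: lee_wpmul2l => //; rewrite lee_fin powR_ge0.
    rewrite muleA -EFinM; apply: lee_wpmul2r; first exact: load_ge0.
    rewrite lee_fin -mulrA; do 2!(rewrite ler_wpM2l ?powR_ge0//).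
    by apply: ler_powRl => //; exact: ltW.
  rewrite -ge0_sume_distrr; last by move=> m _; exact: load_ge0.
  apply: (@le_trans _ _ ((4 `^ beta * 8 `^ t * h j `^ delta)%:E *
      ((6 ^ d)%:R%:E * (eps * l `^ t)%:E))%E).
    apply: lee_wpmul2l; first by rewrite lee_fin !mulr_ge0 ?powR_ge0.
    apply: (@le_trans _ _ ((6 ^ d)%:R%:E * load A a t Q)%E); last first.
      by apply: lee_wpmul2l => //; rewrite lee_fin.
    apply: load_multiplicity => [k|m /sS]; last exact: rectQ.
    have [Ak|Ak] := pselect (A k !=set0); last first.
      rewrite (_ : count _ _ = 0%N)//; apply/eqP; rewrite -leqn0 leqNgt -has_count.
      by apply/negP => /hasP[m _ /asboolP[w [Aw _]]]; apply: Ak; exists w.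
    (* A net rectangle meeting [A k] has a_k < r_m <= h_j, so its centre is within 2 h_j of [p k],
       and the net has at most 6^d such indices. *)
    apply: leq_trans (sc (p k)); 
    rewrite (@eq_in_count _ _ (fun m => `[< A k `&` rect m !=set0 >] && (m \in s j))).
      2: by move=> m ms; rewrite ms andbT.
    apply: sub_count => m /andP[/asboolP mk ms].
    have [_ /andP[_ hm] _ sm] := sS m ms.
    have ak := sm k mk; case: mk => w [Aw Rw].
    have r1 : 0 < r m <= 1 by rewrite r0 /=; have := hjl j; lra.
    have hw := rectangle_norm_le r1 tau1 Rw.
    apply: le_trans (ler_distD w _ _) _.
    have := diamA Aw (pP k Ak); have := r0 m; lra.
  rewrite -!EFinM lee_fin hd /C le_eqVlt; apply/orP; left; apply/eqP.
  by ring.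
have CJ0 : 0 <= C * q ^+ J by apply: (mulr_ge0 (ltW C0)); exact: exprn_ge0 (ltW q0).
have : (\sum_(0 <= j <oo) (\sum_(b <- sl j) b.2 `^ beta)%:E <=
    (kappa / 4 * l `^ beta + kappa / 4 * l `^ beta)%:E)%E.
  apply: (@le_trans _ _ (\sum_(0 <= j <oo)
      ((3 `^ beta * l `^ (beta - t))%:E * (if big j then a j `^ t else 0)%:E +
      (C * q ^+ J * q ^+ j)%:E)%E)%E).
    apply: lee_nneseries => j _.
      by move=> _; rewrite lee_fin sumr_ge0// => b _; exact: powR_ge0.
    by rewrite big_cat EFinD leeD// -EFinM lee_fin.
  rewrite nneseriesD; last 2 first.
  - by move=> j _ _; rewrite -EFinM lee_fin !mulr_ge0 ?powR_ge0// load_term_ge0.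
  - by move=> j _ _; rewrite lee_fin; apply: (mulr_ge0 CJ0); exact: exprn_ge0 (ltW q0).
  rewrite EFinD; apply: leeD.
    rewrite nneseriesZl; last by move=> j _; rewrite lee_fin load_term_ge0.
    apply: (@le_trans _ _ ((3 `^ beta * l `^ (beta - t))%:E * (eps * l `^ t)%:E)%E).
      by apply: lee_wpmul2l => //; rewrite lee_fin mulr_ge0 ?powR_ge0.
    rewrite -EFinM lee_fin.
    rewrite mulrACA.
    by rewrite -powRD ?(gt_eqF l0) ?implybT// subrK ler_wpM2r ?powR_ge0.
  apply: le_trans (nneseries_geometric_le _ _) _.
  - exact: CJ0.
  - by rewrite (ltW q0).
  - by rewrite lee_fin.
move=> h1 h2; have := le_trans h2 h1; rewrite lee_fin; apply/negP; rewrite -ltNge.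
have : 0 < kappa * l `^ beta by rewrite mulr_gt0.
lra.
Qed.

End Step.

(** * Content of the limsup of the balls *)

Section EuclideanNorm.
Context {R : realType} {d : nat}.
Implicit Types (u v x y : 'rV[R]_d).

Lemma norm_le_euclidean v : `|v| <= euclidean_norm v.
Proof.
apply/rV_norm_leP => [|i]; first exact: sqrtr_ge0.
rewrite -sqrtr_sqr ler_wsqrtr// (bigD1 i)//= lerDl sumr_ge0// => j _.
exact: sqr_ge0.
Qed.

(** The crude factor d in place of sqrt d comes from d <= d^2. *)
Lemma euclidean_le_norm v : euclidean_norm v <= d%:R * `|v|.
Proof.
have [d0|d0] := posnP d.
  rewrite /euclidean_norm big1 ?sqrtr0 ?mulr_ge0// => i _.
  by case: i => i hi; exfalso; move: hi; rewrite d0.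
have dv : 0 <= d%:R * `|v| by rewrite mulr_ge0.
rewrite -(ger0_norm dv) -sqrtr_sqr ler_wsqrtr//.
apply: (@le_trans _ _ (\sum_(i < d) `|v| ^+ 2)).
  by apply: ler_sum => i _; rewrite -real_normK ?num_real// lerXn2r ?nnegrE// coord_le_norm.
rewrite sumr_const card_ord -[(`|v| ^+ 2) *+ d]mulr_natl exprMn ler_wpM2r ?sqr_ge0//.
by rewrite -natrX ler_nat leq_pmulr.
Qed.

End EuclideanNorm.

(** * Borel sets and continuity of similarities *)

Section Borel.
Context {R : realType} {d : nat}.

Lemma open_borel (A : set 'rV[R]_d) : open A -> measurable (A : set (borel R d)).
Proof. exact: sub_sigma_algebra. Qed.

Lemma closed_borel (A : set 'rV[R]_d) : closed A -> measurable (A : set (borel R d)).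
Proof.
move=> /closed_openC/open_borel; rewrite -{2}(setCK A).
exact: (@measurableC _ (borel R d)).
Qed.

Lemma continuous_borel (g : 'rV[R]_d -> 'rV[R]_d) (A : set (borel R d)) :
  continuous g -> measurable A -> measurable (g @^-1` A : set (borel R d)).
Proof.
move=> cg mA.
have mg : measurable_fun [set: borel R d] (g : borel R d -> borel R d).
  apply: (@measurability _ _ (borel R d) (borel R d) setT g open) => //.
  move=> _ [B oB <-]; rewrite setTI; apply: open_borel.
  by move/continuousP: cg; exact.
by rewrite -[X in measurable X]setTI; exact: mg.
Qed.

End Borel.

Definition euclidean_similarity {R : realType} {d : nat}
    (g : 'rV[R]_d -> 'rV[R]_d) (c : R) : Prop :=
  forall x y, euclidean_norm (g x - g y) = c * euclidean_norm (x - y).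

Lemma similarity_continuous (R : realType) (d : nat) (g : 'rV[R]_d -> 'rV[R]_d) (c : R) :
  0 < c -> euclidean_similarity g c -> continuous g.
Proof.
move=> c0 hg x U /nbhs_ballP[e /= e0 sub].
have k0 : 0 < c * (d%:R + 1) by rewrite mulr_gt0// ltr_wpDl.
apply/nbhs_ballP; exists (e / (c * (d%:R + 1))); first by rewrite /= divr_gt0.
move=> y; rewrite -ball_normE /ball_ /= ltr_pdivlMr// mulrC => xy.
apply: sub; rewrite -ball_normE /ball_ /=; apply: le_lt_trans xy.
apply: le_trans (norm_le_euclidean _) _.
rewrite hg -mulrA ler_wpM2l ?(ltW c0)//.
by apply: le_trans (euclidean_le_norm _) _; rewrite ler_wpM2r// lerDl.
Qed.

(** The product of the [u i] is a lower bound that is positive even for an empty family. *)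
Lemma uniform_lower_bound (R : realDomainType) (m : nat) (u : 'I_m -> R) :
  (forall i, 0 < u i <= 1) -> exists2 c, 0 < c & forall i, c <= u i.
Proof.
move=> u01; exists (\prod_i u i); first by apply: prodr_gt0 => i _; case/andP: (u01 i).
move=> i; rewrite (bigD1 i)//= ler_piMr//; first by case/andP: (u01 i) => /ltW.
apply: prodr_ile1 => j _; case/andP: (u01 j) => /ltW -> ->//.
Qed.

(** * Small copies of the attractor *)

Section IFS.
Context {R : realType} {d m : nat} (f : 'I_m -> 'rV[R]_d -> 'rV[R]_d)
  (K : set 'rV[R]_d) (p : 'I_m -> R) (mu : probability (borel R d) R).
Hypothesis f_ifs : self_similar_IFS f.
Hypothesis K_attractor : is_attractor f K.
Hypothesis p_prob : probability_vector p.
Hypothesis mu_self_similar : is_self_similar_measure f p mu.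

(** This is what later steps need of self-similarity: it passes to compositions of the [f i], under
    which sets of full measure then have preimages of full measure. *)
Definition null_preserving (g : 'rV[R]_d -> 'rV[R]_d) : Prop :=
  forall A : set (borel R d), measurable A -> mu A = 0%E -> mu (g @^-1` A) = 0%E.

(** Self-similarity writes 0 as a sum of non-negative terms p_j mu(f_j^-1 A), and p_i > 0. *)
Lemma IFS_null_preserving i : null_preserving (f i).
Proof.
move=> A mA A0; have := mu_self_similar mA; rewrite A0.
have p0 j : 0 < p j by case/andP: (p_prob.1 j).
have nn j : (0 <= (p j)%:E * mu (f j @^-1` A))%E.
  by rewrite mule_ge0// lee_fin ltW.
rewrite (bigD1 i)//= => /esym/eqP.
rewrite padde_eq0//; last by apply: sume_ge0 => j _.
move=> /andP[+ _]; rewrite mule_eq0 => /orP[|/eqP//].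
by rewrite eqe (gt_eqF (p0 i)).
Qed.

(** Follow a symbolic address of [z], composing maps until the ratio first drops to [lam] or below;
    the last factor is at least [c0]. *)
Lemma attractor_piece : exists2 c0 : R, 0 < c0 &
  forall (lam : R) (z : 'rV[R]_d), 0 < lam < 1 -> K z ->
  exists g c, [/\ euclidean_similarity g c, null_preserving g,
    c0 * lam <= c <= lam & exists2 y, K y & g y = z].
Proof.
have /choice[c cP] : forall i, exists c, 0 < c < 1 /\ euclidean_similarity (f i) c.
  by move=> i; have [c c01 hc] := f_ifs.2 i; exists c.
have [c0 c0p c0c] : exists2 c0, 0 < c0 & forall i, c0 <= c i.
  apply: uniform_lower_bound => i; have [/andP[-> /ltW ->] _] := cP i; done.
have [e e0 ec] : exists2 e, 0 < e & forall i, e <= 1 - c i.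
  apply: uniform_lower_bound => i; have [/andP[h1 h2] _] := cP i.
  by rewrite subr_gt0 h2 gerBl ltW.
have m0 : (0 < m)%N by apply: leq_trans f_ifs.1.
have e1 : e <= 1.
  have := ec (Ordinal m0); have [/andP[h _] _] := cP (Ordinal m0); lra.
exists c0 => // lam z /andP[lam0 lam1] Kz.
have c1 : c0 <= 1.
  by have := c0c (Ordinal m0); have [/andP[_ h] _] := cP (Ordinal m0); lra.
(* Either the ratio has stopped in the window, or after n steps it is still above [lam] and at most
   (1 - e)^n, which fails for large n. *)
have iter n : exists g cg, [/\ 0 < cg, euclidean_similarity g cg, null_preserving g,
    (c0 * lam <= cg <= lam) \/ (lam < cg /\ cg <= (1 - e) ^+ n) &
    exists2 y, K y & g y = z].
  elim: n => [|n [g [cg [cg0 gs gn [gl|[gl ge]] [y Ky gy]]]]].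
  - exists id, 1; split=> //; [by move=> x y; rewrite mul1r|by right|by exists z].
  - by exists g, cg; split=> //; [left|exists y].
  - move: (Ky); have [_ _ KE] := K_attractor.
    rewrite {1}KE => -[i _ [y' Ky' fy]].
    have [/andP[ci0 ci1] fs] := cP i.
    exists (g \o f i), (cg * c i); split.
    + by rewrite mulr_gt0.
    + by move=> u v; rewrite /= gs fs mulrA.
    + move=> A mA A0; rewrite comp_preimage; apply: IFS_null_preserving; last exact: gn.
      by apply: continuous_borel => //; exact: similarity_continuous gs.
    + have [h|h] := leP (cg * c i) lam; [left|right].
        rewrite andbT mulrC; apply: ler_pM => //; [exact: ltW|exact: ltW|exact: ltW].
      split=> //; rewrite exprSr; apply: ler_pM => //; try exact: ltW.
      by have := ec i; lra.
    + by exists y' => //; rewrite /= fy.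
have : exists n, (1 - e) ^+ n < lam.
  have /cvgrPdist_lt/(_ _ lam0) : (1 - e) ^+ n @[n --> \oo] --> (0 : R).
    by apply: cvg_expr; rewrite ger0_norm; lra.
  move=> [n _ /(_ n (leqnn n))] /=; rewrite sub0r normrN ger0_norm; first by exists n.
  by apply: exprn_ge0; lra.
move=> [n hn]; have [g [cg [cg0 gs gn [gl|[gl ge]] gy]]] := iter n.
  by exists g, cg.
by have := lt_le_trans gl ge; rewrite ltNge (ltW hn).
Qed.

End IFS.

(* The points where mu(B(x,a)) <= C a^beta for all a need not form an obviously
   measurable set; its closure does, and satisfies the same bound with the
   constant C 2^beta. *)
Lemma exact_dimensional_good_set (R : realType) (d : nat)
    (mu : probability (borel R d) R) (alpha beta : R) :
  exact_dimensional mu alpha -> 0 < beta < alpha ->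
  exists C (F : set (borel R d)), [/\ 1 <= C, measurable F, ((2^-1)%:E <= mu F)%E,
    forall x : 'rV[R]_d, F x -> `|x| <= C &
    forall (x : 'rV[R]_d) b, F x -> 0 < b ->
      (mu (ball x b) <= (C * b `^ beta)%:E)%E].
Proof.
move=> [N [mN N0 hN]] /andP[beta0 betaalpha].
have mball (x : 'rV[R]_d) b : measurable (ball x b : set (borel R d)).
  by apply: open_borel; exact: ball_open.
pose G (n : nat) : set 'rV[R]_d := [set x | `|x| <= n%:R /\
  forall b, 0 < b -> (mu (ball x b) <= (n%:R * b `^ beta)%:E)%E].
pose F (n : nat) : set (borel R d) := closure (G n).
have mF n : measurable (F n) by apply: closed_borel; exact: closed_closure.
have homF : {homo F : n m / (n <= m)%N >-> (n <= m)%O}.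
  move=> n m nm; apply/subsetPset; apply: closure_subset => x [xn hx].
  have nmR : n%:R <= m%:R :> R by rewrite ler_nat.
  split; first exact: le_trans nmR.
  move=> b b0; apply: le_trans (hx b b0) _.
  by rewrite lee_fin ler_wpM2r// powR_ge0.
have covF : ~` N `<=` \bigcup_n F n.
  move=> x Nx.
  have hx : ln (fine (mu (closed_ball (x : 'rV[R]_d) b))) / ln b @[b --> 0^'+] --> alpha.
    by apply: contrapT => h; apply: Nx; apply: hN.
  have e0 : 0 < alpha - beta by rewrite subr_gt0.
  have /(@cvgrPdist_lt _ R^o) /(_ _ e0) := hx.
  move=> [e /= e00 he].
  (* Below [e] the logarithmic ratio exceeds beta; below 1 the logarithm of b is negative, so this
     reads mu <= b^beta. *)
  pose b0 := Num.min (e / 2) (1 / 2).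
  have b00 : 0 < b0 by rewrite lt_min !divr_gt0.
  have small b : 0 < b <= b0 -> (mu (ball (x : 'rV[R]_d) b) <= (b `^ beta)%:E)%E.
    move=> /andP[bp]; rewrite le_min => /andP[be b12].
    have b1 : b < 1 by lra.
    have bne : `|0 - b| < e by rewrite sub0r normrN gtr0_norm//; lra.
    have := he b bne bp.
    have mcb : measurable (closed_ball (x : 'rV[R]_d) b : set (borel R d)).
      by apply: closed_borel; exact: closed_ball_closed.
    have fincb : mu (closed_ball (x : 'rV[R]_d) b) \is a fin_num by exact: fin_num_measure.
    have lnb : ln b < 0 by rewrite ln_lt0// bp.
    move=> hlt.
    apply: (@le_trans _ _ (mu (closed_ball (x : 'rV[R]_d) b))).
      by apply: le_measure; rewrite ?inE//; exact: subset_closure.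
    rewrite -(fineK fincb) lee_fin.
    set v := fine _ in hlt *.
    have [v0|v0] := leP v 0; first by apply: le_trans v0 _; exact: powR_ge0.
    have : beta < ln v / ln b by move: hlt; rewrite ltr_norml => /andP[]; lra.
    rewrite ltr_ndivlMr// => h.
    by rewrite /powR (gt_eqF bp) -[v]lnK ?posrE// ler_expR ltW.
  (* The summand 1 serves radii up to [b0]; for larger b, any probability is at most 1 = b0^(-beta)
     b0^beta <= n b^beta. *)
  have [n hn] : exists n : nat, Num.max `|x : 'rV[R]_d| (1 + b0 `^ (- beta)) <= n%:R.
    exists (Num.truncn (Num.max `|x : 'rV[R]_d| (1 + b0 `^ (- beta)))).+1.
    by rewrite ltW// truncnS_gt.
  move: hn; rewrite ge_max => /andP[xn bn].
  have pb : 0 < b0 `^ (- beta) by exact: powR_gt0.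
  exists n => //; apply: subset_closure; split=> // b bp.
  have [bb0|bb0] := leP b b0.
    apply: le_trans (small b _) _; first by rewrite bp.
    by rewrite lee_fin ler_peMl ?powR_ge0//; lra.
  apply: le_trans (probability_le1 _ (mball _ _)) _; rewrite lee_fin.
  have : b0 `^ (- beta) * b0 `^ beta = 1.
    by rewrite -powRD ?addNr ?powRr0// (gt_eqF b00) implybT.
  move=> e1; rewrite -[leLHS]e1; apply: ler_pM; rewrite ?powR_ge0//; first lra.
  by apply: ler_powRl; rewrite ?ltW.
have muF : mu (\bigcup_n F n) = 1%E.
  apply/eqP; rewrite eq_le probability_le1/=; last exact: bigcup_measurable.
  have <- : mu (~` N) = 1%E by rewrite probability_setC// N0 sube0.
  apply: le_measure; rewrite ?inE//; first exact: measurableC.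
  exact: bigcup_measurable.
have cvgF : mu (F n) @[n --> \oo] --> 1%E.
  by rewrite -muF; apply: nondecreasing_cvg_mu => //; exact: bigcup_measurable.
have [n hn] : exists n, ((2^-1)%:E <= mu (F n))%E.
  apply: contrapT => hno.
  have : (lim (mu (F n) @[n --> \oo]) <= (2^-1)%:E)%E.
    apply: lime_le; first by apply/cvg_ex; exists 1%E; exact: cvgF.
    apply: nearW => n; rewrite leNgt; apply/negP => h; apply: hno; exists n; exact: ltW.
  by rewrite (cvg_lim _ cvgF)// lee_fin; lra.
have p2 : 0 < 2 `^ beta :> R by exact: powR_gt0.
(* A point x of the closure has points y of [G n] within 1, and within b, where ball(x, b) lies in
   ball(y, 2b): hence the two terms. *)
pose C := Num.max (n%:R + 1) (n%:R * 2 `^ beta) : R.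
exists C, (F n); split => //.
- by rewrite le_max lerDr ler0n.
- move=> x /(_ (ball x 1)) []; first exact: nbhsx_ballx.
  move=> y [[yn _]]; rewrite -ball_normE /ball_ /= => xy.
  rewrite le_max; apply/orP; left.
  rewrite -[x](subrK y); apply: le_trans (ler_normD _ _) _; lra.
- move=> x b Fx b0; have [|y [[_ hy]]] := Fx (ball x b); first exact: nbhsx_ballx.
  move=> xy; apply: (@le_trans _ _ (mu (ball y (b + b)))).
    apply: le_measure; rewrite ?inE// => w xw.
    by apply: ball_triangle xw; exact: ball_sym.
  apply: le_trans (hy _ _) _; first by rewrite addr_gt0.
  rewrite lee_fin (_ : b + b = 2 * b); last by rewrite mulr_natl mulr2n.
  rewrite powRM ?(ltW b0)// mulrA ler_wpM2r ?powR_ge0//.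
  by rewrite le_max lexx orbT.
Qed.

Lemma bigsetU_measure_le (dd : measure_display) (T : measurableType dd) (R : realType)
    (mu : probability T R) (I : Type) (s : seq I) (F : I -> set T) :
  (forall i, measurable (F i)) ->
  measurable (\big[setU/set0]_(i <- s) F i) /\
  (mu (\big[setU/set0]_(i <- s) F i) <= \sum_(i <- s) mu (F i))%E.
Proof.
move=> mF; elim: s => [|i s [ms IH]].
  by rewrite !big_nil measure0; split.
rewrite !big_cons; split; first exact: measurableU.
by apply: le_trans (measureU2 _ (mF i) ms) _; exact: leeD2l.
Qed.

(** Mass distribution principle: [mu] restricted to [F] and pushed forward by [g] gives the limsup
    mass at least 1/2 and a ball of radius b at most a constant times (b/l)^beta. The constant is
    uniform because the ratio of [g] is comparable to l. *)
Lemma limsup_content (R : realType) (d m : nat) (f : 'I_m -> 'rV[R]_d -> 'rV[R]_d)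
    (K : set 'rV[R]_d) (p : 'I_m -> R) (mu : probability (borel R d) R)
    (x : nat -> 'rV[R]_d) (r : nat -> R) (alpha beta : R) :
  (0 < d)%N -> self_similar_IFS f -> is_attractor f K -> probability_vector p ->
  is_self_similar_measure f p mu -> exact_dimensional mu alpha -> 0 < beta < alpha ->
  mu (lim_sup_set (fun n => closed_ball (x n) (r n))) = 1%E ->
  exists2 kappa, 0 < kappa & forall z l, K z -> 0 < l <= 1 ->
    ball_content_ge (lim_sup_set (fun n => closed_ball (x n) (r n))) beta kappa z l.
Proof.
move=> d0 f_ifs f_K p_prob f_mu mu_alpha beta_alpha muL.
set L := lim_sup_set _ in muL *.
have [beta0 _] := andP beta_alpha.
have mL : measurable (L : set (borel R d)).
  apply: (@bigcap_measurable _ (borel R d)) => // n _.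
  apply: (@bigcup_measurable _ (borel R d)) => k _.
  by apply: closed_borel; exact: closed_ball_closed.
have muLC : mu (~` L) = 0%E by rewrite probability_setC// muL subee.
have [C [F [C1 mF muF FC Fball]]] := exact_dimensional_good_set mu_alpha beta_alpha.
have [c0 c00 piece] := attractor_piece f_ifs f_K p_prob f_mu.
have [rho [rho1 rhoC rhoK]] : exists rho : R, [/\ 1 <= rho, C <= rho &
    forall z, K z -> `|z| <= rho].
  have [_ /compact_bounded[M [_ hM]] _] := f_K.
  exists (Num.max C (M + 1)); split; first by rewrite le_max C1.
    by rewrite le_max lexx.
  by move=> z Kz; rewrite le_max; apply/orP; right; apply: hM => //; rewrite ltrDl.
have dR0 : 1 <= d%:R :> R by rewrite ler1n.
have rho0 : 0 < rho by lra.
have dp : 0 < d%:R :> R by lra.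
(* This is 3d divided by c0 / (4 d rho), the coefficient of l in the lower bound for [c]; thus 3 d b
   / c <= D b / l. *)
pose D := 12 * d%:R ^+ 2 * rho / c0.
have D0 : 0 < D by rewrite divr_gt0// !mulr_gt0// exprn_gt0.
(* Obtained by solving 1/2 <= C D^beta l^(-beta) S for the cost S of a cover. *)
exists (2^-1 / (C * D `^ beta)).
  by rewrite divr_gt0// mulr_gt0 ?powR_gt0//; lra.
move=> z l Kz /andP[l0 l1] s s0 scov.
(* Points of [F] are within 2 rho of [y0], so [g] sends [F] into the cube of radius l/2 about [z]; d
   is the loss between the two norms. *)
pose lam := l / (4 * d%:R * rho).
have den0 : 0 < 4 * d%:R * rho by rewrite !mulr_gt0.
have lam01 : 0 < lam < 1.
  rewrite divr_gt0//= ltr_pdivrMr// mul1r.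
  have : 1 * 1 <= d%:R * rho by apply: ler_pM.
  rewrite -mulrA; lra.
have [g [c [gs gn /andP[c0c clam] [y0 Ky0 gy0]]]] := piece lam z lam01 Kz.
have cp : 0 < c by apply: lt_le_trans c0c; rewrite mulr_gt0//; case/andP: lam01.
have gc : continuous g by exact: similarity_continuous gs.
have mg (A : set (borel R d)) : measurable A -> measurable (g @^-1` A : set (borel R d)).
  exact: continuous_borel.
have expand u v : `|u - v| <= d%:R * `|g u - g v| / c.
  rewrite ler_pdivlMr// mulrC; apply: le_trans (euclidean_le_norm _).
  by rewrite gs ler_wpM2l ?(ltW cp)// norm_le_euclidean.
have contract u v : `|g u - g v| <= c * (d%:R * `|u - v|).
  apply: le_trans (norm_le_euclidean _) _.
  by rewrite gs ler_wpM2l ?(ltW cp)// euclidean_le_norm.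
have Fz u : F u -> `|g u - z| <= l / 2.
  move=> Fu; rewrite -gy0; apply: le_trans (contract _ _) _.
  have huv : `|(u : 'rV[R]_d) - y0| <= 2 * rho.
    apply: le_trans (ler_normB _ _) _; have := FC _ Fu; have := rhoK _ Ky0; lra.
  apply: (@le_trans _ _ (lam * (d%:R * (2 * rho)))).
    by apply: ler_pM; rewrite ?(ltW cp) ?mulr_ge0// ler_wpM2l// ltW.
  rewrite /lam le_eqVlt; apply/orP; left; apply/eqP; field.
  by rewrite !gt_eqF.
(* Non-positive radii get the empty set, so that [frost] holds for every [b]. *)
pose piece_ball (b : 'rV[R]_d * R) : set (borel R d) :=
  if 0 < b.2 then F `&` g @^-1` closed_ball b.1 b.2 else set0.
have mpb b : measurable (piece_ball b).
  rewrite /piece_ball; case: ifP => // _; apply: measurableI => //; apply: mg.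
  by apply: closed_borel; exact: closed_ball_closed.
have frost b : (mu (piece_ball b) <= (C * D `^ beta * l `^ (- beta) * b.2 `^ beta)%:E)%E.
  rewrite /piece_ball; case: ifP => [b0|_]; last first.
    by rewrite measure0 lee_fin !mulr_ge0 ?powR_ge0//; lra.
  have [->|/set0P[w [Fw gw]]] := eqVneq (F `&` g @^-1` closed_ball b.1 b.2) set0.
    by rewrite measure0 lee_fin !mulr_ge0 ?powR_ge0//; lra.
  (* Preimages of points of one ball are within 2 d b / c; the 3 leaves room for an open ball. *)
  pose e := 3 * d%:R * b.2 / c.
  have e0 : 0 < e by rewrite divr_gt0// !mulr_gt0.
  apply: (@le_trans _ _ (mu (ball (w : 'rV[R]_d) e))).
    apply: le_measure; rewrite ?inE//.
    - apply: measurableI => //; apply: mg.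
      by apply: closed_borel; exact: closed_ball_closed.
    - by apply: open_borel; exact: ball_open.
    move=> v [_ gv]; rewrite -ball_normE /ball_ /=.
    apply: le_lt_trans (expand _ _) _; rewrite /e ltr_pM2r ?invr_gt0//.
    rewrite [3 * _]mulrC -mulrA ltr_pM2l//.
    move: gw gv; rewrite /= !closed_ballE// /closed_ball_ /= => gw gv.
    apply: le_lt_trans (ler_distD b.1 _ _) _; move: gw gv.
    rewrite [`|b.1 - g w|]distrC; lra.
  apply: le_trans (Fball _ _ Fw e0) _; rewrite lee_fin.
  rewrite -!mulrA ler_wpM2l//; first lra.
  have eD : e <= D * (l^-1 * b.2).
    rewrite /e ler_pdivrMr//.
    have h : c0 * lam * (D * (l^-1 * b.2)) = 3 * d%:R * b.2.
      rewrite /D /lam; field; rewrite !gt_eqF//.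
    rewrite -h mulrC; apply: ler_wpM2l => //.
    apply: (mulr_ge0 (ltW D0)); apply: mulr_ge0; last exact: ltW.
    by rewrite invr_ge0 ltW.
  apply: (le_trans (ler_powRl (ltW beta0) (ltW e0) eD)).
  have li0 : 0 <= l^-1 by rewrite invr_ge0 ltW.
  rewrite (powRM _ (ltW D0) (mulr_ge0 li0 (ltW b0))).
  by rewrite (powRM _ li0 (ltW b0)) -(powR_inv1 (ltW l0)) -powRrM mulN1r.
pose U j : set (borel R d) := \big[setU/set0]_(b <- s j) piece_ball b.
have mU j : measurable (U j) by exact: (bigsetU_measure_le mu (s j) mpb).1.
pose E : set (borel R d) := F `&` g @^-1` L.
have mE : measurable E by apply: measurableI => //; exact: mg.
have muE : ((2^-1)%:E <= mu E)%E.
  apply: (le_trans muF).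
  have mC : measurable (g @^-1` (~` L) : set (borel R d)) by apply: mg; exact: measurableC.
  apply: (@le_trans _ _ (mu (E `|` g @^-1` (~` L)))).
    apply: le_measure; rewrite ?inE//; first exact: measurableU.
    move=> u Fu; have [gL|gL] := pselect (L (g u)); [by left; split|by right].
  apply: le_trans (measureU2 _ mE mC) _.
  have /eqP := gn _ (measurableC mL) muLC; rewrite eq_le => /andP[gz _].
  by rewrite -[leRHS]adde0; apply: leeD2l; exact: gz.
have EU : E `<=` \bigcup_j U j.
  move=> u [Fu Lu]; have [j [b bs hb]] := scov _ Lu (Fz u Fu).
  exists j => //; rewrite /U -bigcup_seq; exists b => //=.
  have b0 := s0 _ _ bs; rewrite /piece_ball b0.
  split=> //; rewrite /= closed_ballE// /closed_ball_ /= distrC.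
  exact: hb.
have := measure_sigma_subadditive mu mU mE EU => hE.
have : ((2^-1)%:E <= (C * D `^ beta * l `^ (- beta))%:E *
    \sum_(0 <= j <oo) (\sum_(b <- s j) b.2 `^ beta)%:E)%E.
  apply: (le_trans muE); apply: (le_trans hE).
  rewrite -nneseriesZl; last by move=> j _; rewrite lee_fin sumr_ge0// => b _; exact: powR_ge0.
  apply: lee_nneseries => [j _ _|j _]; first exact: measure_ge0.
  apply: (le_trans (bigsetU_measure_le mu (s j) mpb).2).
  rewrite -EFinM mulr_sumr -sumEFin; apply: lee_sum => b _; exact: frost.
have W0 : 0 < C * D `^ beta by rewrite mulr_gt0 ?powR_gt0//; lra.
have V0 : 0 < C * D `^ beta * l `^ (- beta) by rewrite mulr_gt0// powR_gt0.
move=> hfin; rewrite -(@lee_pmul2l _ (C * D `^ beta * l `^ (- beta))%:E)// ?lte_fin//.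
apply: le_trans hfin; rewrite -EFinM lee_fin le_eqVlt; apply/orP; left; apply/eqP.
have ll : l `^ (- beta) * l `^ beta = 1.
  by rewrite -powRD ?addNr ?powRr0// (gt_eqF l0) implybT.
by rewrite mulrACA ll mulr1 mulrC divfK ?gt_eqF.
Qed.

(** * Nested cubes and the dimension bound *)

(** In each coordinate the common point is the supremum of the left endpoints. *)
Lemma nested_closed_balls (R : realType) (d : nat) (z : nat -> 'rV[R]_d) (l : nat -> R) :
  (forall n, 0 < l n) ->
  (forall n, closed_ball (z n.+1) (l n.+1) `<=` closed_ball (z n) (l n)) ->
  exists w, forall n, closed_ball (z n) (l n) w.
Proof.
move=> l0 sub.
have subk n k : closed_ball (z (n + k)%N) (l (n + k)%N) `<=` closed_ball (z n) (l n).
  elim: k => [|k IH]; first by rewrite addn0.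
  by rewrite addnS; apply: subset_trans IH.
have zz n k : `|z n - z (n + k)%N| <= l n.
  have : closed_ball (z n) (l n) (z (n + k)%N).
    by apply: (subk n k); apply: closed_ballxx.
  by rewrite closed_ballE.
have lr i m n : z m ord0 i - l m <= z n ord0 i + l n.
  have := le_trans (coord_le_norm _ i) (zz m n).
  have := le_trans (coord_le_norm _ i) (zz n m).
  rewrite addnC !mxE !ler_norml => /andP[h1 h2] /andP[h3 h4]; lra.
pose B i := [set z m ord0 i - l m | m in [set: nat]].
have supB i : has_sup (B i).
  split; first by exists (z 0%N ord0 i - l 0%N); exists 0%N.
  by exists (z 0%N ord0 i + l 0%N) => _ [m _ <-].
exists (\row_i sup (B i)) => n; rewrite closed_ballE// /closed_ball_ /=.
apply/(rV_norm_leP _ (ltW (l0 n))) => i; rewrite !mxE ler_norml.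
have h1 : z n ord0 i - l n <= sup (B i) by apply: sup_upper_bound => //; exists n.
have h2 : sup (B i) <= z n ord0 i + l n.
  by apply: ge_sup; [exact: (supB i).1|move=> _ [m _ <-]].
by apply/andP; split; lra.
Qed.

(** The content at scale 1 gives diameters D <= 1, so passing from s to t does not raise the cost,
    and t > 0 makes sets of diameter 0 free. Sizes are made positive by a maximum with [e k], whose
    t-th powers sum to eta/2. *)
Lemma hausdorff_null_cover (R : realType) (d : nat) (E : set 'rV[R]_d) (s t eta : R) :
  0 <= s < t -> 0 < eta -> hausdorff_measure s E = 0%E ->
  exists (A : nat -> set 'rV[R]_d) (a : nat -> R), [/\ forall k, 0 < a k,
    forall k y z, A k y -> A k z -> `|y - z| <= a k, E `<=` \bigcup_k A k &
    (\sum_(0 <= k <oo) (a k `^ t)%:E <= eta%:E)%E].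
Proof.
move=> /andP[s0 st] eta0 H0; have t0 : 0 < t by exact: le_lt_trans st.
have : (hausdorff_content s 1 E < (eta / 2)%:E)%E.
  apply: (@le_lt_trans _ _ 0%E); last by rewrite lte_fin divr_gt0.
  rewrite -H0; apply: ereal_sup_ubound; exists 1 => //=; exact: ltr01.
move=> /ereal_inf_lt[_ [U [diamU EU] <-] sumU].
have diam0 k : (0 <= diam (U k))%E by apply: ereal_sup_ubound; left.
have diamfin k : diam (U k) \is a fin_num.
  by rewrite ge0_fin_numE//; apply: le_lt_trans (diamU k) _; exact: ltry.
pose D k := fine (diam (U k)).
have DE k : diam (U k) = (D k)%:E by rewrite fineK.
have D0 k : 0 <= D k by rewrite -lee_fin -DE.
have D1 k : D k <= 1 by rewrite -lee_fin -DE.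
have Dpow k : ((D k `^ t)%:E <= diam_pow s (U k))%E.
  rewrite /diam_pow; case: pselect => [Uk|Uk].
    suff -> : D k = 0 by rewrite powR0// gt_eqF.
    apply/eqP; rewrite eq_le D0 andbT -lee_fin -DE; apply: ge_ereal_sup => u /=.
    by move=> [->|[[y1 y2] [/= Uy _] _]]; [exact: lexx|move: Uy; rewrite Uk].
  rewrite DE poweR_EFin lee_fin.
  have [->|Dk] := eqVneq (D k) 0; first by rewrite [X in X <= _]powR0 ?powR_ge0// gt_eqF.
  by apply: ger_powR (ltW st); rewrite lt_neqAle eq_sym Dk D0 D1.
pose e k := (eta / 4 * 2^-1 ^+ k) `^ t^-1.
have e0 k : 0 < e k by rewrite powR_gt0// mulr_gt0 ?exprn_gt0// divr_gt0.
have et k : e k `^ t = eta / 4 * 2^-1 ^+ k.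
  rewrite /e -powRrM mulVf ?gt_eqF// powRr1// mulr_ge0 ?exprn_ge0// divr_ge0//.
  exact: ltW.
exists U, (fun k => Num.max (D k) (e k)); split=> //.
- by move=> k; rewrite lt_max e0 orbT.
- move=> k y z Uy Uz; rewrite le_max; apply/orP; left.
  rewrite -lee_fin -DE; apply: ereal_sup_ubound; right.
  by exists (y, z).
apply: (@le_trans _ _ (\sum_(0 <= k <oo) (diam_pow s (U k) + (eta / 4 * 2^-1 ^+ k)%:E)%E)%E).
  apply: lee_nneseries => [k _ _|k _]; first by rewrite lee_fin powR_ge0.
  apply: (@le_trans _ _ ((D k `^ t)%:E + (e k `^ t)%:E)%E); last first.
    by rewrite et leeD.
  rewrite -EFinD lee_fin; have [_|_] := leP (D k) (e k).
    by rewrite lerDr powR_ge0.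
  by rewrite lerDl powR_ge0.
rewrite nneseriesD; last 2 first.
- by move=> k _ _; apply: le_trans (Dpow k); rewrite lee_fin powR_ge0.
- by move=> k _ _; rewrite lee_fin mulr_ge0 ?exprn_ge0// divr_ge0// ltW.
apply: (@le_trans _ _ ((eta / 2)%:E + (eta / 2)%:E)%E); last first.
  by rewrite -EFinD lee_fin; lra.
apply: leeD; first exact: ltW.
apply: le_trans (nneseries_geometric_le _ _) _.
- by rewrite divr_ge0// ltW.
- by rewrite invr_ge0 ler0n/= invf_lt1// ltr1n.
- by rewrite lee_fin le_eqVlt; apply/orP; left; apply/eqP; field.
Qed.

(** The summands are 1 for j < floor t, then t - floor t, then 0: the weights of
    [truncated_weights]. *)
Lemma sum_clamp (R : realDomainType) (n : nat) (t : R) : 0 <= t ->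
  \sum_(j < n) Num.min 1 (Num.max 0 (t - j%:R)) = Num.min t n%:R.
Proof.
move=> t0; elim: n => [|n IH]; first by rewrite big_ord0 min_r.
rewrite big_ord_recr /= IH -natr1.
have [h1|h1] := leP t n%:R.
  rewrite [Num.max _ _]max_l ?subr_le0// min_r// addr0 min_l//.
  by rewrite ler_wpDr.
rewrite [Num.max _ _]max_r ?subr_ge0 ?(ltW h1)//.
have [h2|h2] := leP 1 (t - n%:R).
  by rewrite min_r// -lerBrDl.
by rewrite addrC subrK min_l// -lerBlDl ltW.
Qed.

(** Let k = floor t, counted from 0. Then th_j (tau_k - tau_j) is tau_k - tau_j for j < k and 0 for
    j >= k, so the sum in the k-th bound equals t tau_k - sum_i tau_i th_i, and t < bound becomes
    the last inequality. *)
Lemma truncated_weights (R : realType) (d : nat) (tau : 'I_d -> R) (alpha t : R) :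
  0 <= t < d%:R -> (forall i, 0 < tau i) ->
  (forall i : 'I_d, t < (alpha + \sum_(j < d | (j <= i)%N) (tau i - tau j)) / tau i) ->
  exists th : 'I_d -> R, [/\ forall i, 0 <= th i <= 1, t = \sum_i th i &
    \sum_i tau i * th i < alpha].
Proof.
move=> /andP[t0 td] tau0 ht.
pose th (i : 'I_d) : R := Num.min 1 (Num.max 0 (t - i%:R)).
have tE : \sum_i th i = t by rewrite sum_clamp// min_l// ltW.
exists th; split => //.
  by move=> i; rewrite /th le_min ler01 le_max lexx/= ge_min lexx.
have kd : (Num.truncn t < d)%N by rewrite truncn_lt_nat.
have /andP[kt tk] := truncn_itv t0; pose k := Ordinal kd.
have := ht k; rewrite ltr_pdivlMr//.
have -> : \sum_(j < d | (j <= k)%N) (tau k - tau j) = t * tau k - \sum_i tau i * th i.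
  rewrite -{1}tE mulr_suml -sumrB big_mkcond; apply: eq_bigr => j _ /=.
  case: (ltngtP j (Num.truncn t)) => jk.
  - have : j.+1%:R <= t.
      by apply: le_trans kt; rewrite ler_nat.
    rewrite -natr1 => h; rewrite /th max_r; last lra.
    by rewrite min_l; lra.
  - have : (Num.truncn t).+1%:R <= j%:R :> R by rewrite ler_nat.
    move=> h; rewrite /th max_l; last lra.
    by rewrite min_r// mulr0 mul0r subrr.
  - have -> : j = k by exact: val_inj.
    by rewrite subrr mulrC subrr.
lra.
Qed.

(** A grid of (M+1)^d cubes of radius 1/M costs at most 2^d M^(d - beta), which tends to 0 if beta >
    d. It serves to place t below d, so that floor t indexes a coordinate. *)
Lemma ball_content_exponent_le (R : realType) (d : nat) (L : set 'rV[R]_d)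
    (beta kappa : R) (z : 'rV[R]_d) :
  0 < kappa -> ball_content_ge L beta kappa z 1 -> beta <= d%:R.
Proof.
move=> kappa0 content; rewrite leNgt; apply/negP => dbeta.
pose delta := beta - d%:R.
have delta0 : 0 < delta by rewrite subr_gt0.
(* Solves c^delta = 2^d / kappa, so M > c brings the cost below kappa. *)
pose c := (2 ^+ d / kappa) `^ delta^-1.
pose M := (Num.truncn c).+1.
have Mc : c < M%:R by exact: truncnS_gt.
have M0 : 0 < M%:R :> R by rewrite ltr0n.
have c0 : 0 <= c by exact: powR_ge0.
have Md : 2 ^+ d / kappa < M%:R `^ delta.
  have -> : 2 ^+ d / kappa = c `^ delta.
    by rewrite /c -powRrM mulVf ?gt_eqF// powRr1// divr_ge0 ?exprn_ge0// ltW.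
  by apply: gt0_ltr_powR; rewrite ?nnegrE// ltW.
pose y (g : {ffun 'I_d -> 'I_M.+1}) : 'rV[R]_d :=
  \row_i (z ord0 i - 1 / 2 + (g i)%:R / M%:R).
pose s j : seq ('rV[R]_d * R) :=
  if j is 0%N then [seq (y g, M%:R^-1) | g <- enum {ffun 'I_d -> 'I_M.+1}] else [::].
have s0 j b : b \in s j -> 0 < b.2.
  by case: j => //= /mapP[g _ ->]; rewrite invr_gt0.
have := content s s0.
have cov w : L w -> `|w - z| <= 1 / 2 -> exists j, exists2 b, b \in s j & `|w - b.1| <= b.2.
  move=> _ wz; pose u i := (w ord0 i - z ord0 i + 1 / 2) * M%:R.
  have wzi i : -(1 / 2) <= w ord0 i - z ord0 i <= 1 / 2.
    by have := le_trans (coord_le_norm _ i) wz; rewrite !mxE ler_norml.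
  have u0 i : 0 <= u i.
    by rewrite mulr_ge0//; have /andP[h _] := wzi i; lra.
  have uM i : (Num.truncn (u i) < M.+1)%N.
    rewrite ltnS truncn_le_nat -natr1.
    apply: (@le_lt_trans _ _ M%:R); last by rewrite ltrDl.
    by rewrite ler_piMl//; have /andP[_ h] := wzi i; lra.
  pose g : {ffun 'I_d -> 'I_M.+1} := [ffun i => Ordinal (uM i)].
  exists 0%N, (y g, M%:R^-1); first by apply/mapP; exists g => //; rewrite mem_enum.
  apply/rV_norm_leP => [|i]; first by rewrite invr_ge0.
  rewrite !mxE ffunE /=; have /andP[h1 h2] := truncn_itv (u0 i).
  rewrite -natr1 in h2.
  have wE : w ord0 i = u i / M%:R + z ord0 i - 1 / 2.
    by rewrite /u mulfK ?gt_eqF//; lra.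
  have h3 : (Num.truncn (u i))%:R / M%:R <= u i / M%:R by rewrite ler_pM2r ?invr_gt0.
  have h4 : u i / M%:R < (Num.truncn (u i))%:R / M%:R + M%:R^-1.
    by rewrite -[X in _ + X]mul1r -mulrDl ltr_pM2r ?invr_gt0.
  by rewrite wE ler_norml; apply/andP; split; lra.
move=> /(_ cov); rewrite powR1 mulr1.
have nn j : (0 <= (\sum_(b <- s j) b.2 `^ beta)%:E)%E.
  by rewrite lee_fin sumr_ge0// => b _; exact: powR_ge0.
rewrite (@nneseriesD1 _ _ 0%N _ (fun j _ => nn j))//.
rewrite eseries0 ?adde0; last first.
  by move=> j _ /=; case: j => // j _; rewrite /s big_nil.
rewrite lee_fin /s big_map /= big_const_seq iter_addr_0 count_predT.
rewrite -cardE card_ffun !card_ord; apply/negP; rewrite -ltNge.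
rewrite -[_ *+ (M.+1 ^ d)]mulr_natl natrX.
apply: (@le_lt_trans _ _ ((2 * M%:R) ^+ d * (M%:R^-1) `^ beta)).
  rewrite ler_wpM2r ?powR_ge0// lerXn2r ?nnegrE ?mulr_ge0//.
  by rewrite -natrM ler_nat; lia.
rewrite exprMn -powR_inv1// -powRrM mulN1r -(powR_mulrn d (ltW M0)) -mulrA -powRD; last first.
  by rewrite (gt_eqF M0) implybT.
have -> : d%:R - beta = - delta by rewrite opprB.
rewrite powRN ltr_pdivrMr ?powR_gt0//.
by move: Md; rewrite ltr_pdivrMr// mulrC.
Qed.

Lemma limsup_rectangles_not_null (R : realType) (d m : nat)
    (f : 'I_m -> 'rV[R]_d -> 'rV[R]_d) (K : set 'rV[R]_d) (p : 'I_m -> R)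
    (mu : probability (borel R d) R) (tau : 'I_d -> R) (x : nat -> 'rV[R]_d)
    (r : nat -> R) (alpha s : R) :
  (0 < d)%N -> self_similar_IFS f -> is_attractor f K -> interior K !=set0 ->
  probability_vector p -> is_self_similar_measure f p mu ->
  (forall i, 1 <= tau i) -> (forall n, 0 < r n) -> r n @[n --> \oo] --> 0 ->
  mu (lim_sup_set (fun n => closed_ball (x n) (r n))) = 1%E ->
  exact_dimensional mu alpha -> 0 <= s ->
  (forall i : 'I_d, s < (alpha + \sum_(j < d | (j <= i)%N) (tau i - tau j)) / tau i) ->
  hausdorff_measure s
    (lim_sup_set (fun n => interior (rectangle tau (x n) (r n)))) <> 0%E.
Proof.
move=> d0 f_ifs f_K [z0 intKz0] p_prob f_mu tau1 r0 rcvg muL mu_alpha s0 hs Hnull.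
have tau0 i : 0 < tau i by apply: lt_le_trans (tau1 i).
have [z00 Kball] : exists e : {posnum R}, ball z0 e%:num `<=` K.
  by move: intKz0 => /nbhs_ballP[e /= e0 sub]; exists (PosNum e0).
have Kz0 : K z0 by apply: Kball; exact: ballxx.
pose bound (i : 'I_d) := (alpha + \sum_(j < d | (j <= i)%N) (tau i - tau j)) / tau i.
(* The cap at 1 fits [uniform_lower_bound]; adding c/2 to s stays strictly below every term of the
   minimum. *)
have [c c0 cb] : exists2 c, 0 < c & forall i, c <= Num.min 1 (bound i - s).
  apply: uniform_lower_bound => i; rewrite lt_min ltr01 subr_gt0 hs /=.
  by rewrite ge_min lexx.
pose t := s + c / 2.
have st : s < t by rewrite ltrDl divr_gt0.
have t0 : 0 < t by exact: le_lt_trans st.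
have ht (i : 'I_d) : t < bound i.
  have := cb i; rewrite le_min => /andP[_]; rewrite /t; lra.
have alpha_gt0 : t < alpha.
  have := ht (Ordinal d0); rewrite /bound big1 ?addr0; last first.
    move=> j /= ; rewrite leqn0 => /eqP j0; rewrite (_ : j = Ordinal d0) ?subrr//.
    exact: val_inj.
  rewrite ltr_pdivlMr// => h; apply: le_lt_trans h.
  by rewrite ler_peMr// ltW.
have content beta : 0 < beta < alpha -> exists2 kappa, 0 < kappa &
    forall z l, K z -> 0 < l <= 1 ->
    ball_content_ge (lim_sup_set (fun n => closed_ball (x n) (r n))) beta kappa z l.
  by move=> hb; exact: (limsup_content d0 f_ifs f_K p_prob f_mu mu_alpha hb muL).
(* The content estimate at an exponent b strictly between t and alpha forces b <= d. *)
have td : t < d%:R.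
  pose b := (t + alpha) / 2.
  have hb : 0 < b < alpha by rewrite /b; apply/andP; split; lra.
  have [kappa k0 /(_ z0 1 Kz0)] := content b hb.
  rewrite ltr01 lexx => /(_ isT) hc.
  have := ball_content_exponent_le k0 hc; rewrite /b; lra.
have [th [th01 tE sigma_alpha]] := truncated_weights
  (introT andP (conj (ltW t0) td)) tau0 ht.
set sigma := \sum_i tau i * th i in sigma_alpha.
have sigma0 : 0 <= sigma.
  by apply: sumr_ge0 => i _; rewrite mulr_ge0 ?(ltW (tau0 i))//; case/andP: (th01 i).
pose beta := (sigma + alpha) / 2.
have sb : sigma < beta by rewrite /beta; lra.
have [kappa k0 hcontent] : exists2 kappa, 0 < kappa &
    forall z l, K z -> 0 < l <= 1 ->
    ball_content_ge (lim_sup_set (fun n => closed_ball (x n) (r n))) beta kappa z l.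
  by apply: content; rewrite /beta; apply/andP; split; lra.
have p3 : 0 < 3 `^ beta :> R by exact: powR_gt0.
pose eps := Num.min 1 (kappa / 4 / 3 `^ beta).
have eps01 : 0 < eps <= 1.
  by rewrite lt_min ltr01 ge_min lexx /= !divr_gt0.
have epsk : 3 `^ beta * eps <= kappa / 4.
  by rewrite mulrC -ler_pdivlMr// ge_min lexx orbT.
have [eps0 eps1] := andP eps01.
pose l0 : R := Num.min 1 (z00%:num / 2).
have l00 : 0 < l0 by rewrite lt_min ltr01 divr_gt0.
have l01 : 0 < l0 <= 1 by rewrite l00 ge_min lexx.
have cbK : closed_ball z0 l0 `<=` K.
  apply: subset_trans Kball; rewrite closed_ballE// => w; rewrite /closed_ball_ /= => hw.
  rewrite -ball_normE /ball_ /=; apply: le_lt_trans hw _.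
  by rewrite gt_min; apply/orP; right; rewrite ltr_pdivrMr// ltr_pMr// ltr1n.
(* With this total, [Q 0] satisfies the load bound even if every set of the cover meets it. *)
have eta0 : 0 < eps * l0 `^ t by rewrite mulr_gt0 ?powR_gt0.
have [A [a [a0 diamA EA sumA]]] :=
  hausdorff_null_cover (introT andP (conj s0 st)) eta0 Hnull.
(* Inclusion in [K] keeps each centre in [K], where the content estimate is available; the first
   cube has it because [K] has interior. *)
pose inv (q : 'rV[R]_d * R) := [/\ 0 < q.2 <= 1, closed_ball q.1 q.2 `<=` K &
  (load A a t (closed_ball q.1 q.2) <= (eps * q.2 `^ t)%:E)%E].
(* The invariant is a premise inside [next] so that [step] can be chosen on all pairs; where it
   fails any value will do. *)
pose next (N : nat) (q q' : 'rV[R]_d * R) := inv q -> [/\ inv q', q'.2 <= q.2 / 2,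
  closed_ball q'.1 q'.2 `<=` closed_ball q.1 q.2 &
  exists2 n, (N <= n)%N &
    closed_ball q'.1 q'.2 `<=` interior (rectangle tau (x n) (r n))].
have /choice[step stepP] : forall Nq : nat * ('rV[R]_d * R), exists q', next Nq.1 Nq.2 q'.
  move=> [N q]; have [iq|niq] := pselect (inv q); last by exists q.
  have [q01 qK qload] := iq.
  have q0 : 0 < q.2 by case/andP: q01.
  have Kq : K q.1 by apply: qK; exact: closed_ballxx.
  have [n [z' [l' [Nn /andP[l'0 l'l] sub1 sub2 ld]]]] :=
    covering_step tau1 th01 tE t0 sb r0 rcvg a0 diamA N k0 eps01 epsk q01
      (hcontent _ _ Kq q01) qload.
  exists (z', l') => _ /=; split=> //; last by exists n.
  split=> //=; last by apply: subset_trans qK.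
  by rewrite l'0 /=; have /andP[_ q1] := q01; lra.
(* Step n asks for a rectangle of index at least n, which puts the common point in the limsup. *)
pose Q := fix Q n := if n is n'.+1 then step (n', Q n') else (z0, l0).
have invQ n : inv (Q n).
  elim: n => [|n IH]; last by have [] := stepP (n, Q n) IH.
  split=> //=; apply: le_trans sumA; apply: lee_nneseries => k _.
    by move=> _; rewrite lee_fin load_term_ge0.
  by rewrite lee_fin; case: ifP => // _; exact: powR_ge0.
have Q0 n : 0 < (Q n).2 by have [/andP[]] := invQ n.
have [w wQ] : exists w, forall n, closed_ball (Q n).1 (Q n).2 w.
  apply: nested_closed_balls => n; first exact: Q0.
  by have [] := stepP (n, Q n) (invQ n).
have Ql n : (Q n).2 <= 2^-1 ^+ n.
  elim: n => [|n IH]; first by rewrite expr0; case/andP: l01.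
  have [_ h _ _] := stepP (n, Q n) (invQ n).
  by rewrite exprSr; apply: le_trans h _; rewrite ler_pM2r.
have Ew : lim_sup_set (fun n => interior (rectangle tau (x n) (r n))) w.
  move=> N _; have [_ _ _ [n Nn sub]] := stepP (N, Q N) (invQ N).
  by exists n => //; apply: sub; exact: (wQ N.+1).
have [k _ Akw] := EA _ Ew.
have akQ n : a k <= (Q n).2.
  have [_ _ ld] := invQ n.
  have := le_trans (load_ge a t (ex_intro _ w (conj Akw (wQ n)))) ld.
  rewrite lee_fin leNgt => h; rewrite leNgt; apply/negP => lak; move/negP: h; apply.
  apply: (@le_lt_trans _ _ ((Q n).2 `^ t)); first by rewrite ler_piMl// powR_ge0.
  by apply: gt0_ltr_powR; rewrite ?nnegrE ?(ltW (Q0 n)) ?(ltW (a0 k)).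
have /cvgrPdist_lt/(_ _ (a0 k))[n _ /(_ n (leqnn n))] : 2^-1 ^+ n @[n --> \oo] --> (0 : R).
  by apply: cvg_expr; rewrite ger0_norm// invf_lt1// ltr1n.
rewrite /= sub0r normrN ger0_norm ?exprn_ge0// => h.
by have := le_trans (akQ n) (Ql n); rewrite leNgt h.
Qed.

Theorem theorem2p13 (R : realType) (d : nat) (d_gt0 : (0 < d)%N)
  (m : nat) (f : 'I_m -> 'rV[R]_d -> 'rV[R]_d) (K : set 'rV[R]_d)
  (p : 'I_m -> R) (mu : probability (borel R d) R)
  (tau : 'I_d -> R) (x : nat -> 'rV[R]_d) (r : nat -> R)
  (f_ifs : self_similar_IFS f)
  (K_attractor : is_attractor f K)
  (K_regular : K = closure (interior K))
  (p_prob : probability_vector p)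
  (mu_self_similar : is_self_similar_measure f p mu)
  (tau_ge1 : forall i, 1 <= tau i)
  (tau_mono : forall i j : 'I_d, (i <= j)%N -> tau i <= tau j)
  (r_gt0 : forall n, 0 < r n)
  (r_cvg0 : r n @[n --> \oo] --> 0)
  (mu_limsup : mu (lim_sup_set (fun n => closed_ball (x n) (r n))) = 1%E) :
  (\big[Order.min/+oo]_(i < d)
     ((measure_dim mu + \sum_(j < d | (j <= i)%N) (tau i - tau j)) / tau i)%:E
   <= hausdorff_dim
        (lim_sup_set (fun n => interior (rectangle tau (x n) (r n)))))%E.
Proof.
apply: le_ereal_inf_tmp => _ /= [s [s0 Hs] <-].
rewrite leNgt; apply/negP => slt.
have hs (i : 'I_d) :
    s < (measure_dim mu + \sum_(j < d | (j <= i)%N) (tau i - tau j)) / tau i.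
  rewrite -lte_fin; apply: (lt_le_trans slt).
  exact: (@bigmin_le_cond _ _ _ _ _ _ (fun i : 'I_d =>
    ((measure_dim mu + \sum_(j < d | (j <= i)%N) (tau i - tau j)) / tau i)%:E)).
have [[alpha mu_alpha]|not_exact] := pselect (exists a, exact_dimensional mu a).
  have intK : interior K !=set0.
    have [[z Kz] _ _] := K_attractor.
    have {}Kz : closure (interior K) z by rewrite -K_regular.
    by have [|w [Kw _]] := Kz setT; [exact: filterT|exists w].
  rewrite (measure_dimE mu_alpha) in hs.
  exact: (limsup_rectangles_not_null d_gt0 f_ifs K_attractor intK p_prob
    mu_self_similar tau_ge1 r_gt0 r_cvg0 mu_limsup mu_alpha s0 hs).
have := hs (Ordinal d_gt0); rewrite /measure_dim xgetPN; last first.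
  by move=> a ha; apply: not_exact; exists a.
rewrite big1 ?addr0 ?mul0r ?ltNge ?s0// => j /=; rewrite leqn0 => /eqP j0.
by rewrite (_ : j = Ordinal d_gt0) ?subrr//; exact: val_inj.
Qed.
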